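(* Every polynomial identity of degree $\le 5$ relating the bilinear operation $[x,y]=\alpha(x\wedge y)$ and the trilinear operation $(x,y,z)=\beta(x\wedge y)\cdot z$ on the $\mathfrak{sl}(2,\mathbb{C})$-module $V(6)$ is a consequence of the following identities: (1) anticommutativity: $[a,b]+[b,a]\equiv0$; (2) skew-symmetry: $(a,b,c)+(b,a,c)\equiv0$; (3) the mixed Jacobi identity: $[[a,b],c]+[[b,c],a]+[[c,a],b]+(a,b,c)+(b,c,a)+(c,a,b)\equiv0$; (4) the Malcev identity: $[[[a,c],b],d]+[[[d,a],c],b]+[[[c,b],d],a]+[[[b,d],a],c]-[[a,b],[c,d]]\equiv0$; (5) the two mixed identities in degree 4: $([a,b],c,d)+([b,c],a,d)+([c,a],b,d)\equiv0$ and $[(a,b,c),d]-[(a,b,d),c]-(a,b,[c,d])\equiv0$; (6) the 18-term identity, where $[x,y]$ is written as juxtaposition $xy$: $$\begin{aligned} &-(((ab)c)e)d+(((ab)e)d)c+(((ac)b)d)e-(((ac)d)e)b\\ &-(((ad)b)c)e-(((ad)c)b)e+(((ae)b)c)d+(((ae)c)b)d\\ &+(((bd)c)a)e-(((be)a)d)c+(((be)c)d)a-(((be)d)a)c\\ &+(((cd)a)e)b-(((cd)b)e)a+(((cd)e)a)b-(((ce)b)a)d\\ &+((ab)c)(de)+((ac)b)(de)\equiv0; \end{aligned}$$ (7) the ternary derivation identity: $((a,b,c),d,e)-((a,b,d),c,e)-(a,b,(c,d,e))+(c,d,(a,b,e))\equiv0$; and the 31-term mixed identity in degree 5: $$\begin{aligned}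 &-[[[[a,b],e],d],c]-[[[[a,c],b],d],e]-[[[[a,c],e],d],b]+[[[[a,d],c],b],e]\\ &+[[[[a,e],d],b],c]+[[[[a,e],d],c],b]+[[[[b,c],d],a],e]-[[[[b,d],a],c],e]\\ &-[[[[b,d],a],e],c]-[[[[c,d],a],e],b]-[[[[d,e],b],a],c]-[[[[d,e],c],a],b]\\ &-[[(a,c,d),b],e]-[[(a,c,d),e],b]-[[(a,d,c),e],b]+[[(b,c,d),e],a]\\ &-[[(b,d,c),a],e]-[[(c,e,d),a],b]-[[(d,e,c),a],b]-[[(d,e,c),b],a]\\ &+[[[a,b],[c,d]],e]+[[[a,d],[b,e]],c]+[[[a,d],[c,e]],b]\\ &+[(a,d,c),[b,e]]-[(b,c,d),[a,e]]-[(b,d,c),[a,e]]-[(c,e,d),[a,b]]\\ &+([[a,b],e],c,d)+([[a,e],b],c,d)+([[a,e],b],d,c)+([[b,e],a],d,c)\equiv0. \end{aligned}$$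
   Context: $V(6)$ is the 7-dimensional irreducible $\mathfrak{sl}(2,\mathbb{C})$-module with basis $v_6,v_4,v_2,v_0,v_{-2},v_{-4},v_{-6}$ of $H$-eigenvectors, where $H\cdot v_{6-2i}=(6-2i)v_{6-2i}$, $E\cdot v_{6-2i}=(7-i)v_{6-2(i-1)}$, $F\cdot v_{6-2i}=(i+1)v_{6-2(i+1)}$ (with $v_8=v_{-8}=0$). Here $H,E,F$ is the standard basis of $\mathfrak{sl}(2,\mathbb{C})$, with $[H,E]=2E$, $[H,F]=-2F$, $[E,F]=H$. The map $\alpha\colon\Lambda^2V(6)\to V(6)$ is the (unique up to nonzero scalar) nonzero $\mathfrak{sl}(2,\mathbb{C})$-module morphism, normalized so that $[x,y]=\alpha(x\wedge y)$ is the anticommutative product with $[v_6,v_0]=20v_6$, $[v_6,v_{-2}]=10v_4$, $[v_6,v_{-4}]=4v_2$, $[v_6,v_{-6}]=v_0$, $[v_4,v_2]=-60v_6$, $[v_4,v_0]=-20v_4$, $[v_4,v_{-4}]=6v_0$, $[v_4,v_{-6}]=4v_{-2}$, $[v_2,v_0]=-20v_2$, $[v_2,v_{-2}]=-15v_0$, $[v_2,v_{-6}]=10v_{-4}$, $[v_0,v_{-2}]=-20v_{-2}$, $[v_0,v_{-4}]=-20v_{-4}$, $[v_0,v_{-6}]=20v_{-6}$, $[v_{-2},v_{-4}]=-60v_{-6}$, and all other products $[v_p,v_q]$ with $p>q$ equal to $0$. The map $\beta\colon\Lambda^2V(6)\to V(2)\approx\mathfrak{sl}(2,\mathbb{C})$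 is an $\mathfrak{sl}(2,\mathbb{C})$-module morphism, unique up to nonzero scalar; its scalar is chosen compatibly with $\alpha$ as $\beta=-30\,\beta_0$, where, with $u_2=-E$, $u_0=H$, $u_{-2}=F$, $\beta_0(v_6\wedge v_{-4})=2u_2$, $\beta_0(v_6\wedge v_{-6})=u_0$, $\beta_0(v_4\wedge v_{-2})=-10u_2$, $\beta_0(v_4\wedge v_{-4})=-4u_0$, $\beta_0(v_4\wedge v_{-6})=2u_{-2}$, $\beta_0(v_2\wedge v_0)=20u_2$, $\beta_0(v_2\wedge v_{-2})=5u_0$, $\beta_0(v_2\wedge v_{-4})=-10u_{-2}$, $\beta_0(v_0\wedge v_{-2})=20u_{-2}$, and $\beta_0(v_p\wedge v_q)=0$ for all other $p>q$. The dot in $\beta(x\wedge y)\cdot z$ is the action of $\mathfrak{sl}(2,\mathbb{C})$ on $V(6)$. A polynomial identity of degree $\le n$ relating the two operations is a nonassociative polynomial over $\mathbb{C}$ of degree $\le n$, each of whose monomials may involve the bilinear operation, the trilinear operation, or both, which vanishes for all substitutions of elements of $V(6)$ for the variables. An identity is a consequence of a set of identities if it is satisfied by every vector space over $\mathbb{C}$ with a bilinear and a trilinear operation satisfying all identities in the set. *)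

(* Defs.v *)
From HB Require Import structures.
From mathcomp Require Import all_boot all_order all_algebra.
From mathcomp Require Import finmap complex reals.
From mathcomp Require Import monalg.

Set Implicit Arguments.
Unset Strict Implicit.
Unset Printing Implicit Defensive.

Import GRing.Theory.

Local Open Scope ring_scope.

(* Monomials in one bilinear operation [x, y] and one trilinear operation
   (x, y, z), the latter written <(x, y, z)> to avoid a clash with tuples. *)
Inductive nmono : Type :=
| Var of nat
| Bin of nmono & nmono
| Tri of nmono & nmono & nmono.

Declare Scope nmono_scope.
Delimit Scope nmono_scope with nmono.
Bind Scope nmono_scope with nmono.

Notation "[ x , y ]" := (Bin x y)
  (at level 0, format "[ x ,  y ]") : nmono_scope.
Notation "<( x , y , z )>" := (Tri x y z)
  (at level 0, format "<( x ,  y ,  z )>") : nmono_scope.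

Fixpoint nmono_encode (m : nmono) : GenTree.tree nat :=
  match m with
  | Var i => GenTree.Leaf i
  | Bin x y => GenTree.Node 0 [:: nmono_encode x; nmono_encode y]
  | Tri x y z =>
      GenTree.Node 1 [:: nmono_encode x; nmono_encode y; nmono_encode z]
  end.

Fixpoint nmono_decode (t : GenTree.tree nat) : nmono :=
  match t with
  | GenTree.Leaf i => Var i
  | GenTree.Node _ [:: x; y] => Bin (nmono_decode x) (nmono_decode y)
  | GenTree.Node _ [:: x; y; z] =>
      Tri (nmono_decode x) (nmono_decode y) (nmono_decode z)
  | _ => Var 0
  end.

Lemma nmono_encodeK : cancel nmono_encode nmono_decode.
Proof. by elim=> //= [x -> y ->|x -> y -> z ->]. Qed.

HB.instance Definition _ := Choice.copy nmono (can_type nmono_encodeK).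

Fixpoint nmono_degree (m : nmono) : nat :=
  match m with
  | Var _ => 1
  | Bin x y => nmono_degree x + nmono_degree y
  | Tri x y z => nmono_degree x + nmono_degree y + nmono_degree z
  end.

(* Nonassociative polynomials: the free vector space on the monomials, without
   unit, hence without constant terms. *)
Definition nap (K : fieldType) := {malg K[nmono]}.

Definition nap_degree (K : fieldType) (p : nap K) : nat :=
  \max_(m <- msupp p) nmono_degree m.

Section Evaluation.

Variables (K : fieldType) (W : lmodType K).
Variables (br : W -> W -> W) (tr : W -> W -> W -> W).

Fixpoint nmono_eval (e : nat -> W) (m : nmono) : W :=
  match m with
  | Var i => e i
  | Bin x y => br (nmono_eval e x) (nmono_eval e y)
  | Tri x y z => tr (nmono_eval e x) (nmono_eval e y) (nmono_eval e z)
  end.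

Definition nap_eval (e : nat -> W) (p : nap K) : W :=
  \sum_(m <- msupp p) p@_m *: nmono_eval e m.

Definition identity_of (p : nap K) : Prop :=
  forall e : nat -> W, nap_eval e p = 0.

Definition trilinear : Prop :=
  [/\ forall y z, linear (fun x => tr x y z),
      forall x z, linear (fun y => tr x y z)
    & forall x y, linear (fun z => tr x y z)].

End Evaluation.

Definition consequence (K : fieldType) (S : seq (nap K)) (p : nap K) : Prop :=
  forall (W : lmodType K) (br : {bilinear W -> W -> W})
         (tr : W -> W -> W -> W),
    trilinear tr ->
    (forall q : nap K, q \in S -> identity_of br tr q) ->
    identity_of br tr p.

Section V6.

Variable K : fieldType.

(* The i-th coordinate of a row vector is its coefficient on v_(6 - 2i). *)
Definition V6 := 'rV[K]_7.

Definition wt (i : 'I_7) : int := 6 - 2 * i%:Z.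

(* vwt w is the weight vector v_w; it is 0 when w is not a weight of V(6), which
   implements the convention v_8 = v_(-8) = 0. *)
Definition vwt (w : int) : V6 := \row_i (wt i == w)%:R.

Definition coordV6 (w : int) (x : V6) : K := \sum_(i | wt i == w) x 0 i.

Definition actH (x : V6) : V6 :=
  \sum_(i < 7) x 0 i *: ((wt i)%:~R *: vwt (wt i)).
Definition actE (x : V6) : V6 :=
  \sum_(i < 7) x 0 i *: ((7 - i)%N%:R *: vwt (wt i + 2)).
Definition actF (x : V6) : V6 :=
  \sum_(i < 7) x 0 i *: ((i + 1)%N%:R *: vwt (wt i - 2)).

Definition sl2E : 'M[K]_2 := delta_mx 0 1.
Definition sl2F : 'M[K]_2 := delta_mx 1 0.
Definition sl2H : 'M[K]_2 := delta_mx 0 0 - delta_mx 1 1.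

(* A traceless 2 x 2 matrix X equals X01 E + X10 F + X00 H; only traceless
   matrices are ever passed to sl2_act. *)
Definition sl2_act (X : 'M[K]_2) (x : V6) : V6 :=
  X 0 1 *: actE x + X 1 0 *: actF x + X 0 0 *: actH x.

(* The coefficient of x ^ y on the basis element v_p ^ v_q of the exterior
   square. *)
Definition wedge_coord (p q : int) (x y : V6) : K :=
  coordV6 p x * coordV6 q y - coordV6 q x * coordV6 p y.

(* The linear map on the exterior square sending v_p ^ v_q to u for each
   (p, q, u) in the table, and the other v_p ^ v_q with p > q to 0. *)
Definition wedge_map (U : lmodType K) (table : seq (int * int * U))
    (x y : V6) : U :=
  \sum_(t <- table) wedge_coord t.1.1 t.1.2 x y *: t.2.

Definition alpha_table : seq (int * int * V6) :=
  [:: (6, 0, 20 *: vwt 6); (6, -2, 10 *: vwt 4); (6, -4, 4 *: vwt 2);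
      (6, -6, vwt 0);
      (4, 2, - 60 *: vwt 6); (4, 0, - 20 *: vwt 4); (4, -4, 6 *: vwt 0);
      (4, -6, 4 *: vwt (-2));
      (2, 0, - 20 *: vwt 2); (2, -2, - 15 *: vwt 0); (2, -6, 10 *: vwt (-4));
      (0, -2, - 20 *: vwt (-2)); (0, -4, - 20 *: vwt (-4));
      (0, -6, 20 *: vwt (-6));
      (-2, -4, - 60 *: vwt (-6))].

Definition alpha (x y : V6) : V6 := wedge_map alpha_table x y.

Definition u2 : 'M[K]_2 := - sl2E.
Definition u0 : 'M[K]_2 := sl2H.
Definition um2 : 'M[K]_2 := sl2F.

Definition beta0_table : seq (int * int * 'M[K]_2) :=
  [:: (6, -4, 2 *: u2); (6, -6, u0);
      (4, -2, - 10 *: u2); (4, -4, - 4 *: u0); (4, -6, 2 *: um2);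
      (2, 0, 20 *: u2); (2, -2, 5 *: u0); (2, -4, - 10 *: um2);
      (0, -2, 20 *: um2)].

Definition beta (x y : V6) : 'M[K]_2 := - 30 *: wedge_map beta0_table x y.

Definition beta_act (x y z : V6) : V6 := sl2_act (beta x y) z.

End V6.

Section Identities.

Variable K : fieldType.

Local Notation a := (Var 0).
Local Notation b := (Var 1).
Local Notation c := (Var 2).
Local Notation d := (Var 3).
Local Notation e := (Var 4).

Local Open Scope nmono_scope.
Local Open Scope ring_scope.

Definition anticommutativity : nap K :=
  << [a, b] >> + << [b, a] >>.

Definition skew_symmetry : nap K :=
  << <(a, b, c)> >> + << <(b, a, c)> >>.

Definition mixed_jacobi : nap K :=
  << [[a, b], c] >> + << [[b, c], a] >> + << [[c, a], b] >>
  + << <(a, b, c)> >> + << <(b, c, a)> >> + << <(c, a, b)> >>.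

Definition malcev : nap K :=
  << [[[a, c], b], d] >> + << [[[d, a], c], b] >> + << [[[c, b], d], a] >>
  + << [[[b, d], a], c] >> - << [[a, b], [c, d]] >>.

Definition mixed4_bracket : nap K :=
  << <([a, b], c, d)> >> + << <([b, c], a, d)> >> + << <([c, a], b, d)> >>.

Definition mixed4_derivation : nap K :=
  << [<(a, b, c)>, d] >> - << [<(a, b, d)>, c] >> - << <(a, b, [c, d])> >>.

Definition identity18 : nap K :=
  - << [[[[a, b], c], e], d] >> + << [[[[a, b], e], d], c] >>
  + << [[[[a, c], b], d], e] >> - << [[[[a, c], d], e], b] >>
  - << [[[[a, d], b], c], e] >> - << [[[[a, d], c], b], e] >>
  + << [[[[a, e], b], c], d] >> + << [[[[a, e], c], b], d] >>
  + << [[[[b, d], c], a], e] >> - << [[[[b, e], a], d], c] >>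
  + << [[[[b, e], c], d], a] >> - << [[[[b, e], d], a], c] >>
  + << [[[[c, d], a], e], b] >> - << [[[[c, d], b], e], a] >>
  + << [[[[c, d], e], a], b] >> - << [[[[c, e], b], a], d] >>
  + << [[[a, b], c], [d, e]] >> + << [[[a, c], b], [d, e]] >>.

Definition ternary_derivation : nap K :=
  << <(<(a, b, c)>, d, e)> >> - << <(<(a, b, d)>, c, e)> >>
  - << <(a, b, <(c, d, e)>)> >> + << <(c, d, <(a, b, e)>)> >>.

Definition identity31 : nap K :=
  - << [[[[a, b], e], d], c] >> - << [[[[a, c], b], d], e] >>
  - << [[[[a, c], e], d], b] >> + << [[[[a, d], c], b], e] >>
  + << [[[[a, e], d], b], c] >> + << [[[[a, e], d], c], b] >>
  + << [[[[b, c], d], a], e] >> - << [[[[b, d], a], c], e] >>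
  - << [[[[b, d], a], e], c] >> - << [[[[c, d], a], e], b] >>
  - << [[[[d, e], b], a], c] >> - << [[[[d, e], c], a], b] >>
  - << [[<(a, c, d)>, b], e] >> - << [[<(a, c, d)>, e], b] >>
  - << [[<(a, d, c)>, e], b] >> + << [[<(b, c, d)>, e], a] >>
  - << [[<(b, d, c)>, a], e] >> - << [[<(c, e, d)>, a], b] >>
  - << [[<(d, e, c)>, a], b] >> - << [[<(d, e, c)>, b], a] >>
  + << [[[a, b], [c, d]], e] >> + << [[[a, d], [b, e]], c] >>
  + << [[[a, d], [c, e]], b] >> + << [<(a, d, c)>, [b, e]] >>
  - << [<(b, c, d)>, [a, e]] >> - << [<(b, d, c)>, [a, e]] >>
  - << [<(c, e, d)>, [a, b]] >> + << <([[a, b], e], c, d)> >>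
  + << <([[a, e], b], c, d)> >> + << <([[a, e], b], d, c)> >>
  + << <([[b, e], a], d, c)> >>.

Definition identities : seq (nap K) :=
  [:: anticommutativity; skew_symmetry; mixed_jacobi; malcev;
      mixed4_bracket; mixed4_derivation;
      identity18; ternary_derivation; identity31].

End Identities.

(* Main.v *)
From HB Require Import structures.
From Stdlib Require Import ZArith.
Require Import Defs.
From mathcomp Require Import all_boot all_order all_algebra.
From mathcomp Require Import finmap complex reals monalg.
From mathcomp Require Import zify ssrZ ring.

(** The theorem is a comparison of two ranks in each degree n <= 5.

    Over a field of characteristic 0 an identity of degree at most 5 splits into
    its homogeneous components ([homogeneous_component]), and a homogeneous one
    is equivalent to its polarizations, which are multilinear ([polar_eq0] for
    the module V(6), [sum_polar] for the way back).  So only the finite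
    dimensional space M_n spanned by the multilinear monomials in n variables
    matters.  The two skew-symmetries reduce its spanning set to the monomials in
    skew normal form, of which there are 1, 1, 6, 45 and 510 for n = 1, ..., 5.

    On M_n there are two kinds of linear data.  Substituting weight vectors of
    V(6) for the variables and summing the coordinates of the result gives
    functionals phi_w, one for each word w of weights; every identity of V(6)
    lies in their common kernel.  The identities of the theorem, lifted to
    degree n and with permuted variables, give relations, which vanish on V(6).
    The point is that these relations span the whole common kernel of the
    phi_w.  It is enough to exhibit a splitting of the normal monomials into two
    parts P and N, as many relations as there are elements of P, and as many
    words as there are elements of N, such that
    - the chosen relations, restricted to P, form a nonsingular matrix;
    - the chosen phi_w, restricted to N, form a nonsingular matrix;
    - the chosen phi_w vanish on the chosen relations.
    For n = 1, ..., 5 the set N has 1, 1, 5, 21 and 123 elements.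

    In an algebra W which satisfies the identities this gives, for fixed values
    y of the variables, elements g_w of W with m(y) = sum_w phi_w(m) g_w for
    every multilinear monomial m ([reconstruction]): the second property lets one
    solve for the g_w on N, and then both sides satisfy the chosen relations,
    which determine the values on P from those on N.  A multilinear polynomial
    killed by all phi_w is therefore killed in W.

    The matrices are integral, and nonsingularity is tested by elimination
    without row exchanges ([lu]).  Sparse data for which the elimination stays
    small are found by a greedy search ([find_certificate]). *)

Set Implicit Arguments.
Unset Strict Implicit.
Unset Printing Implicit Defensive.

Import GRing.Theory Num.Theory.

Local Open Scope ring_scope.

(* The key Z denotes the scope of int. *)
Delimit Scope Z_scope with ZZ.

(** * Elimination over the integers *)

(** The combination a v + b w, the shorter vector being padded with zeros. *)
Fixpoint comb (a : Z) (v : seq Z) (b : Z) (w : seq Z) : seq Z :=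
  match v, w with
  | x :: v', y :: w' => Z.add (Z.mul a x) (Z.mul b y) :: comb a v' b w'
  | _, [::] => [seq Z.mul a x | x <- v]
  | [::], _ => [seq Z.mul b y | y <- w]
  end.

(** Coprime a and b with a d = b c, where d is the first entry of s; dividing out
    the gcd keeps the entries small. *)
Definition multipliers (c : Z) (s : seq Z) : Z * Z :=
  let d := head Z0 s in if Z.eqb d Z0 then (Zpos xH, Z0) else (Z.ggcd c d).2.

(** The pivot row is c :: r; the cleared column is dropped, so that elimination
    recurses on shorter rows. *)
Definition clear_head (c : Z) (r s : seq Z) : seq Z :=
  if Z.eqb (head Z0 s) Z0 then behead s
  else let q := multipliers c s in comb q.1 (behead s) (Z.opp q.2) r.

(** Elimination without row exchanges succeeds exactly when the leading principal
    minors of A of orders 1, ..., n are nonzero. *)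
Fixpoint lu (n : nat) (A : seq (seq Z)) : bool :=
  match n, A with
  | 0, _ => true
  | n'.+1, (c :: r) :: A' =>
      ~~ Z.eqb c Z0 && lu n' [seq clear_head c r s | s <- A']
  | _, _ => false
  end.

Definition ofZ (K : pzRingType) (c : Z) : K := (int_of_Z c)%:~R.

Section OfZ.

Variable K : numFieldType.
Local Notation ofZ := (ofZ K).

Lemma ofZD c d : ofZ (Z.add c d) = ofZ c + ofZ d.
Proof. by rewrite /ofZ -intrD; congr (_%:~R); lia. Qed.

Lemma ofZM c d : ofZ (Z.mul c d) = ofZ c * ofZ d.
Proof. by rewrite /ofZ -intrM; congr (_%:~R); lia. Qed.

Lemma ofZN c : ofZ (Z.opp c) = - ofZ c.
Proof. by rewrite /ofZ -mulrNz; congr (_%:~R); lia. Qed.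

Lemma ofZ_eq0 c : (ofZ c == 0) = (c == Z0).
Proof. by rewrite /ofZ intr_eq0; case: c => //= p; lia. Qed.

Lemma ofZ0 : ofZ Z0 = 0. Proof. by []. Qed.

End OfZ.

Section Dot.

Variables (K : numFieldType) (U : lmodType K).
Local Notation ofZ := (ofZ K).

(** The unknowns of a linear system may lie in any vector space: in the algebra
    W for the relations, in the base field for the values on V(6). *)
Fixpoint dot (v : seq Z) (x : seq U) : U :=
  match v, x with
  | c :: v', u :: x' => ofZ c *: u + dot v' x'
  | _, _ => 0
  end.

Lemma dot_cons v u x :
  dot v (u :: x) = ofZ (head Z0 v) *: u + dot (behead v) x.
Proof. by case: v => //=; rewrite scale0r add0r; case: x. Qed.

Lemma dotE v x : dot v x = \sum_(i < size x) ofZ (nth Z0 v i) *: nth 0 x i.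
Proof.
elim: x v => [|u x IHx] [|c v]; rewrite ?big_ord0 //=.
  by rewrite big1 // => i _; rewrite nth_nil scale0r.
by rewrite big_ord_recl IHx.
Qed.

Lemma nth_comb a v b w i :
  nth Z0 (comb a v b w) i
  = Z.add (Z.mul a (nth Z0 v i)) (Z.mul b (nth Z0 w i)).
Proof.
have nth_scale d s j : nth Z0 [seq Z.mul d x | x <- s] j = Z.mul d (nth Z0 s j).
  by elim: s j => [|x s IHs] [|j] //=; rewrite Z.mul_0_r.
elim: v w i => [|x v IHv] [|y w] i.
- by rewrite nth_nil !Z.mul_0_r.
- by rewrite nth_scale nth_nil Z.mul_0_r.
- by rewrite nth_scale nth_nil Z.mul_0_r Z.add_0_r.
- by case: i => [|i] //=.
Qed.

Lemma dot_comb a v b w x :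
  dot (comb a v b w) x = ofZ a *: dot v x + ofZ b *: dot w x.
Proof.
rewrite !dotE !scaler_sumr -big_split /=; apply: eq_bigr => i _.
by rewrite nth_comb ofZD !ofZM scalerDl !scalerA.
Qed.

Lemma multipliersP (c : Z) (s : seq Z) (q := multipliers c s) : c != Z0 ->
  ofZ q.1 != 0 /\ ofZ q.1 * ofZ (head Z0 s) = ofZ q.2 * ofZ c.
Proof.
rewrite {}/q /multipliers => c0; case: Z.eqb_spec => [->|_] /=.
  by rewrite oner_eq0 mulr0 mul0r.
move: (Z.ggcd_correct_divisors c (head Z0 s)).
case: Z.ggcd => g [a b] /= [Ec Ed]; split; last first.
  by rewrite Ec Ed !ofZM mulrCA [RHS]mulrCA [ofZ b * _]mulrC.
by rewrite ofZ_eq0; apply: contraNneq c0 => a0; rewrite Ec a0 Z.mul_0_r.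
Qed.

Lemma dot_clear_head c r s x (q := multipliers c s) :
  dot (clear_head c r s) x = ofZ q.1 *: dot (behead s) x - ofZ q.2 *: dot r x.
Proof.
rewrite {}/q /clear_head /multipliers; case: Z.eqb_spec => _ /=.
  by rewrite scale1r scale0r subr0.
by rewrite dot_comb ofZN scaleNr.
Qed.

(** Forward elimination isolates the last unknowns, which vanish by induction;
    the pivot row then kills the first one. *)
Lemma lu_inj n A x : lu n A -> size x = n ->
  (forall v, v \in A -> dot v x = 0) -> forall u, u \in x -> u = 0.
Proof.
elim: n A x => [|n IHn] [|[|c r] A] // [|u x] //= /andP[c0 luA] [sz_x] Ax0.
have {}c0 : c != Z0 by apply: contra c0 => /eqP->.
have rx0 := Ax0 _ (mem_head _ _).
have x0 : forall v, v \in x -> v = 0.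
  apply: IHn luA sz_x _ => _ /mapP[s sA ->].
  have [a0 Eab] := multipliersP s c0; rewrite dot_clear_head.
  have: dot s (u :: x) = 0 by rewrite Ax0 // inE sA orbT.
  move/(congr1 ( *:%R (ofZ (multipliers c s).1))).
  move/(congr1 ( *:%R (ofZ (multipliers c s).2))): rx0.
  rewrite !dot_cons !scaler0 !scalerDr !scalerA /= -Eab => E1 E2.
  by move/addrI: (etrans E2 (esym E1)) => ->; rewrite subrr.
move=> v; rewrite inE => /predU1P[->|]; last exact: x0.
have rx_eq0 : dot r x = 0.
  rewrite dotE big1 // => i _.
  by rewrite (x0 (nth 0 x i)) ?scaler0 ?mem_nth.
move: rx0; rewrite dot_cons /= rx_eq0 addr0.
by move/eqP; rewrite scaler_eq0 ofZ_eq0 (negPf c0) => /eqP.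
Qed.

(** The right-hand side undergoes the same row operations, and back substitution
    divides by the pivots, which are invertible in characteristic 0. *)
Lemma lu_solve n A y : lu n A -> size A = n -> size y = n ->
  exists2 x : seq U, size x = n & [seq dot v x | v <- A] = y.
Proof.
elim: n A y => [|n IHn] [|[|c r] A] // [|u y] //=; first by exists [::].
case/andP=> c0 luA [szA] [szy].
have {}c0 : c != Z0 by apply: contra c0 => /eqP->.
have c0' : ofZ c != 0 by rewrite ofZ_eq0.
pose q s := multipliers c s.
pose y' := [seq ofZ (q p.1).1 *: p.2 - ofZ (q p.1).2 *: u | p <- zip A y].
have [||x sz_x Ex] := IHn _ y' luA.
- by rewrite size_map.
- by rewrite size_map size_zip szA szy minnn.
exists ((ofZ c)^-1 *: (u - dot r x) :: x); rewrite /= ?sz_x //.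
rewrite scalerA mulfV // scale1r subrK; congr (_ :: _).
apply: (@eq_from_nth _ 0) => [|i]; rewrite size_map ?szA // => lt_i.
have := congr1 (nth 0 ^~ i) Ex; rewrite /y' -map_comp.
have lt_i' : (i < size (zip A y))%N by rewrite size_zip szA szy minnn.
rewrite /= !(nth_map [::]) ?szA // (nth_map ([::], 0)) // nth_zip ?szA //=.
set s := nth [::] A i; have [a0 Eab] := multipliersP s c0.
rewrite dot_clear_head dot_cons scalerA => /eqP; rewrite subr_eq => /eqP Es.
apply: (scalerI a0); rewrite scalerDr Es !scalerA mulrA Eab mulfK //.
rewrite -addrA [- _ + _]addrC -scalerBr -[_ - u]opprB scalerN.
by rewrite addrCA subrr addr0.
Qed.

End Dot.

(** * Integer polynomials and their evaluation *)

Definition zpoly := seq (Z * nmono).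

Ltac reify_nap p :=
  lazymatch p with
  | ?x + ?y =>
      let s := reify_nap x in let t := reify_nap y in constr:(s ++ t)
  | - << ?m >> => constr:([:: (Zneg xH, m)])
  | << ?m >> => constr:([:: (Zpos xH, m)])
  end.

Ltac reify_identity p :=
  let q := eval red in p in
  let r := reify_nap q in
  let s := eval cbv [cat] in r in exact s.

(** The coefficients are 1 and -1 over every field; the rationals only serve to
    make the expressions closed. *)
Definition anticommutativityZ : zpoly :=
  ltac:(reify_identity (anticommutativity rat)).
Definition skew_symmetryZ : zpoly :=
  ltac:(reify_identity (skew_symmetry rat)).
Definition mixed_jacobiZ : zpoly :=
  ltac:(reify_identity (mixed_jacobi rat)).
Definition malcevZ : zpoly :=
  ltac:(reify_identity (malcev rat)).
Definition mixed4_bracketZ : zpoly :=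
  ltac:(reify_identity (mixed4_bracket rat)).
Definition mixed4_derivationZ : zpoly :=
  ltac:(reify_identity (mixed4_derivation rat)).
Definition identity18Z : zpoly :=
  ltac:(reify_identity (identity18 rat)).
Definition ternary_derivationZ : zpoly :=
  ltac:(reify_identity (ternary_derivation rat)).
Definition identity31Z : zpoly :=
  ltac:(reify_identity (identity31 rat)).

Definition identitiesZ : seq zpoly :=
  [:: anticommutativityZ; skew_symmetryZ; mixed_jacobiZ; malcevZ;
      mixed4_bracketZ; mixed4_derivationZ;
      identity18Z; ternary_derivationZ; identity31Z].

Fixpoint subst (f : nat -> nmono) (m : nmono) : nmono :=
  match m with
  | Var i => f i
  | Bin x y => Bin (subst f x) (subst f y)
  | Tri x y z => Tri (subst f x) (subst f y) (subst f z)
  end.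

Definition zmap (f : nmono -> nmono) (r : zpoly) : zpoly :=
  [seq (t.1, f t.2) | t <- r].

Lemma nmono_degree_gt0 m : (0 < nmono_degree m)%N.
Proof. by elim: m => //= [x IHx y _|x IHx y _ z _]; rewrite ?addn_gt0 IHx. Qed.

Definition bilin (K : numFieldType) (W : lmodType K) (br : W -> W -> W) :=
  (forall y, linear (br^~ y)) /\ (forall x, linear (br x)).

Lemma linear_comb (K : numFieldType) (U V : lmodType K) (f : U -> V)
    I (r : seq I) (c : I -> K) (x : I -> U) :
  linear f ->
  f (\sum_(i <- r) c i *: x i) = \sum_(i <- r) c i *: f (x i).
Proof.
move=> lin_f; elim: r => [|i r IHr]; last by rewrite !big_cons lin_f IHr.
rewrite !big_nil; have := lin_f (-1) 0 0.
by rewrite scaler0 addr0 scaleN1r addNr.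
Qed.

Lemma linear_scale (K : numFieldType) (U V : lmodType K) (f : U -> V) a u :
  linear f -> f (a *: u) = a *: f u.
Proof.
move=> lin_f; have := linear_comb [:: tt] (fun=> a) (fun=> u) lin_f.
by rewrite !big_seq1.
Qed.

Section Eval.

Variables (K : numFieldType) (W : lmodType K).
Variables (br : W -> W -> W) (tr : W -> W -> W -> W).
Local Notation ev := (nmono_eval br tr).
Local Notation ofZ := (ofZ K).

Definition zeval (e : nat -> W) (r : zpoly) : W :=
  \sum_(t <- r) ofZ t.1 *: ev e t.2.

Definition holds (r : zpoly) : Prop := forall e, zeval e r = 0.

Lemma ev_subst e f m : ev e (subst f m) = ev (fun i => ev e (f i)) m.
Proof. by elim: m => //= [x -> y ->|x -> y -> z ->]. Qed.

Lemma holds_subst f r : holds r -> holds (zmap (subst f) r).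
Proof.
move=> r0 e; rewrite -[RHS](r0 (fun i => ev e (f i))) /zeval big_map.
by apply: eq_bigr => t _; rewrite ev_subst.
Qed.

Lemma holds_linear (C : nmono -> nmono) r (F : (nat -> W) -> W -> W) :
  (forall e, linear (F e)) -> (forall e m, ev e (C m) = F e (ev e m)) ->
  holds r -> holds (zmap C r).
Proof.
move=> linF CF r0 e.
have := linear_comb r (fun t => ofZ t.1) (fun t => ev e t.2) (linF e).
rewrite [\sum_(i <- r) _](r0 e) => F0; rewrite /zeval big_map /=.
under eq_bigr do rewrite CF.
by rewrite -F0 -[X in F e X](scale0r (0 : W)) linear_scale // scale0r.
Qed.

End Eval.

Section PolynomialOf.

Variable K : numFieldType.

Definition nap_of (r : zpoly) : nap K := \sum_(t <- r) ofZ K t.1 *: << t.2 >>.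

Lemma nap_evalE (W : lmodType K) br tr (e : nat -> W) (d : {fset nmono})
    (p : nap K) : (msupp p `<=` d)%fset ->
  nap_eval br tr e p = \sum_(m <- d) p@_m *: nmono_eval br tr e m.
Proof.
move=> le_pd; rewrite /nap_eval (big_fset_incl _ le_pd) // => m _ m_p.
by rewrite mcoeff_outdom // scale0r.
Qed.

Lemma nap_eval_of (W : lmodType K) br tr (e : nat -> W) r :
  nap_eval br tr e (nap_of r) = zeval br tr e r.
Proof.
elim: r => [|[c m] r IHr]; rewrite /nap_of /zeval ?big_nil ?big_cons /=.
  by rewrite /nap_eval msupp0 big_seq_fset0.
rewrite -/(nap_of r) -/(zeval br tr e r) -IHr.
set q := nap_of r; pose d := (msupp q `|` [fset m])%fset.
rewrite !(@nap_evalE _ _ _ e d) ?fsubsetUl //; last first.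
  apply: fsubset_trans (msuppD_le _ _) _; rewrite fsubUset fsubsetUl andbT.
  apply: fsubset_trans (msuppZ_le _ _) _.
  exact: fsubset_trans msuppU_le (fsubsetUr _ _).
have -> : ofZ K c *: nmono_eval br tr e m
    = \sum_(m' <- d) (ofZ K c * (m == m')%:R) *: nmono_eval br tr e m'.
  rewrite (big_fsetD1 m) /= ?inE ?eqxx ?orbT //= mulr1 big1_fset ?addr0 // => m'.
  by rewrite !inE eq_sym => /andP[/negPf-> _]; rewrite mulr0 scale0r.
rewrite -big_split /=; apply: eq_bigr => m' _.
by rewrite mcoeffD mcoeffZ mcoeffU scalerDl.
Qed.

Lemma nap_of_identities : map nap_of identitiesZ = identities K.
Proof.
pose term (c : Z) m : nap K :=
  match c with
  | Zpos xH => << m >> | Zneg xH => - << m >> | _ => ofZ K c *: << m >>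
  end.
have termE c m : ofZ K c *: << m >> = term c m.
  by case: c => [|[]|[]] //=; rewrite ?scale1r // (ofZN K (Zpos xH)) scaleN1r.
have last c m : nap_of [:: (c, m)] = term c m.
  by rewrite /nap_of big_seq1 termE.
have cons c m t r : nap_of [:: (c, m), t & r] = term c m + nap_of (t :: r).
  by rewrite /nap_of big_cons termE.
rewrite /identities /identitiesZ /=.
congr [:: _; _; _; _; _; _; _; _; _].
all: [> rewrite /anticommutativityZ | rewrite /skew_symmetryZ
      | rewrite /mixed_jacobiZ | rewrite /malcevZ | rewrite /mixed4_bracketZ
      | rewrite /mixed4_derivationZ | rewrite /identity18Z
      | rewrite /ternary_derivationZ | rewrite /identity31Z].
all: rewrite !cons last {cons last}; cbn [term]; rewrite ?addrA; reflexivity.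
Qed.

End PolynomialOf.

(** * Consequences of the identities in each degree *)

Definition single (i : nat) (m : nmono) (k : nat) : nmono :=
  if k == i then m else Var k.

(** Up to the order of the variables and the two skew-symmetries, the multilinear
    consequences in degree n + 1 of a multilinear r of degree n arise by
    replacing a variable by a bracket or by bracketing with a new variable. *)
Definition lift1 (n : nat) (r : zpoly) : seq zpoly :=
  [seq zmap (subst (single i (Bin (Var i) (Var n)))) r | i <- iota 0 n]
  ++ [:: zmap (Bin^~ (Var n)) r].

(** The same in degree n + 2, for the trilinear operation; putting r in
    the second argument gives nothing new by skew-symmetry. *)
Definition lift2 (n : nat) (r : zpoly) : seq zpoly :=
  [seq zmap (subst (single i (Tri (Var i) (Var n) (Var n.+1)))) r
     | i <- iota 0 n]
  ++ [:: zmap (fun m => Tri m (Var n) (Var n.+1)) r;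
         zmap (Tri (Var n) (Var n.+1)) r].

Definition gens3 : seq zpoly := [:: mixed_jacobiZ].
Definition gens4 : seq zpoly :=
  [:: mixed4_bracketZ; mixed4_derivationZ; malcevZ]
  ++ flatten (map (lift1 3) gens3).
Definition gens5 : seq zpoly :=
  [:: ternary_derivationZ; identity18Z; identity31Z]
  ++ flatten (map (lift1 4) gens4) ++ flatten (map (lift2 3) gens3).

Definition gens (n : nat) : seq zpoly :=
  match n with 3 => gens3 | 4 => gens4 | 5 => gens5 | _ => [::] end.

Section Consequences.

Variables (K : numFieldType) (W : lmodType K).
Variables (br : W -> W -> W) (tr : W -> W -> W -> W).
Hypothesis br_bilin : bilin br.
Hypothesis tr_trilin : trilinear tr.
Local Notation holds := (holds br tr).

Lemma holds_lift1 n r : holds r -> forall s, s \in lift1 n r -> holds s.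
Proof.
move=> r0 s; rewrite mem_cat => /orP[/mapP[i _ ->]|]; first exact: holds_subst.
rewrite inE => /eqP->.
apply: (holds_linear (F := fun e x => br x (e n))) r0 => // e.
exact: br_bilin.1.
Qed.

Lemma holds_lift2 n r : holds r -> forall s, s \in lift2 n r -> holds s.
Proof.
case: tr_trilin => tr1 tr2 tr3 r0 s; rewrite mem_cat.
case/orP=> [/mapP[i _ ->]|]; first exact: holds_subst.
rewrite !inE => /orP[] /eqP->.
  by apply: (holds_linear (F := fun e x => tr x (e n) (e n.+1))) r0.
by apply: (holds_linear (F := fun e x => tr (e n) (e n.+1) x)) r0.
Qed.

Lemma holds_gens n r : (forall s, s \in identitiesZ -> holds s) ->
  r \in gens n -> holds r.
Proof.
move=> ids0.
have ids k : (k < 9)%N -> holds (nth [::] identitiesZ k).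
  by move=> lt_k; apply: ids0; apply: mem_nth.
have H3 s : s \in gens3 -> holds s by rewrite inE => /eqP->; apply: (ids 2).
have H4 s : s \in gens4 -> holds s.
  rewrite mem_cat => /orP[|/flatten_mapP[t /H3 t0]]; last exact: holds_lift1.
  rewrite !inE => /or3P[] /eqP->.
  - exact: (ids 4).
  - exact: (ids 5).
  - exact: (ids 3).
have H5 s : s \in gens5 -> holds s.
  rewrite mem_cat => /orP[|]; last rewrite mem_cat => /orP[].
  - rewrite !inE => /or3P[] /eqP->.
    + exact: (ids 7).
    + exact: (ids 6).
    + exact: (ids 8).
  - by case/flatten_mapP=> t /H4 t0; apply: holds_lift1.
  - by case/flatten_mapP=> t /H3 t0; apply: holds_lift2.
by case: n => [|[|[|[|[|[|n]]]]]] //=; [apply: H3|apply: H4|apply: H5].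
Qed.

End Consequences.

(** * Skew normal form *)

Fixpoint head_var (m : nmono) : nat :=
  match m with
  | Var i => i
  | Bin x _ => head_var x
  | Tri x _ _ => head_var x
  end.

Definition skew_swap (F : nmono -> nmono -> nmono) (x y : bool * nmono) :
    bool * nmono :=
  if (head_var y.2 < head_var x.2)%N then (~~ (x.1 (+) y.1), F y.2 x.2)
  else (x.1 (+) y.1, F x.2 y.2).

(** The two skew arguments of each operation are put in increasing order of their
    first variables, which are distinct in a multilinear monomial; the boolean
    records the sign. *)
Fixpoint skew_norm (m : nmono) : bool * nmono :=
  match m with
  | Var _ => (false, m)
  | Bin x y => skew_swap Bin (skew_norm x) (skew_norm y)
  | Tri x y z =>
      let: (s, z') := skew_norm z in
      let: (t, m') :=
        skew_swap (fun a b => Tri a b z') (skew_norm x) (skew_norm y) in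
      (s (+) t, m')
  end.

Definition zpoly_norm (r : zpoly) : zpoly :=
  [seq let: (s, m) := skew_norm t.2 in (if s then Z.opp t.1 else t.1, m)
     | t <- r].

Section SkewNorm.

Variables (K : numFieldType) (W : lmodType K).
Variables (br : W -> W -> W) (tr : W -> W -> W -> W).
Hypothesis br_bilin : bilin br.
Hypothesis tr_trilin : trilinear tr.
Hypothesis br_skew : forall x y, br x y = - br y x.
Hypothesis tr_skew : forall x y z, tr x y z = - tr y x z.
Local Notation ev := (nmono_eval br tr).

Lemma ev_skew_norm e m :
  ev e m = (-1) ^+ (skew_norm m).1 *: ev e (skew_norm m).2.
Proof.
case: tr_trilin br_bilin => tr1 tr2 tr3 [br1 br2].
elim: m => [i|x IHx y IHy|x IHx y IHy z IHz] //=; first by rewrite scale1r.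
  rewrite IHx IHy (linear_scale _ _ (br1 _)) (linear_scale _ _ (br2 _)).
  rewrite scalerA -signr_addb /skew_swap.
  by case: ifP => _ //=; rewrite br_skew signrN scaleNr scalerN.
rewrite IHx IHy IHz (linear_scale _ _ (tr1 _ _)) (linear_scale _ _ (tr2 _ _)).
rewrite (linear_scale _ _ (tr3 _ _)).
case: (skew_norm z) => [s z']; rewrite /skew_swap !scalerA -!signr_addb.
case: ifP => _ /=; last by rewrite addbC.
by rewrite tr_skew scalerN -scaleNr -signrN addbC addbN.
Qed.

Lemma zeval_norm e r : zeval br tr e (zpoly_norm r) = zeval br tr e r.
Proof.
rewrite /zeval big_map; apply: eq_bigr => -[c m] _ /=; rewrite (ev_skew_norm e m).
case: (skew_norm m) => [[] m'] /=; last by rewrite scale1r.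
by rewrite ofZN scaleNr expr1 scaleN1r scalerN.
Qed.

End SkewNorm.

(** * Multilinear monomials *)

(** The generic equality on monomials goes through an encoding into trees, which
    is slow to evaluate. *)
Fixpoint eqnm (m m' : nmono) : bool :=
  match m, m' with
  | Var i, Var j => eqn i j
  | Bin x y, Bin x' y' => eqnm x x' && eqnm y y'
  | Tri x y z, Tri x' y' z' => [&& eqnm x x', eqnm y y' & eqnm z z']
  | _, _ => false
  end.

Definition memm (m : nmono) (s : seq nmono) : bool := has (eqnm m) s.

Lemma eqnmP m m' : reflect (m = m') (eqnm m m').
Proof.
apply: (iffP idP) => [|<-]; last first.
  by elim: m => /= [i|x -> y -> //|x -> y -> z -> //]; exact: (eqxx i).
elim: m m' => [i|x IHx y IHy|x IHx y IHy z IHz] [j|x' y'|x' y' z'] //=.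
- by move/eqP->.
- by case/andP=> /IHx-> /IHy->.
- by case/and3P=> /IHx-> /IHy-> /IHz->.
Qed.

Lemma memmE m s : memm m s = (m \in s).
Proof.
apply/hasP/idP => [[m' m's /eqnmP->] //|ms].
by exists m => //; apply/eqnmP.
Qed.

Fixpoint leaves (m : nmono) : seq nat :=
  match m with
  | Var i => [:: i]
  | Bin x y => leaves x ++ leaves y
  | Tri x y z => leaves x ++ leaves y ++ leaves z
  end.

(** The monomial of the shape of m whose variables, read from left to right, are
    the entries of k. *)
Fixpoint fill (k : seq nat) (m : nmono) : nmono :=
  match m with
  | Var _ => Var (head 0%N k)
  | Bin x y => Bin (fill k x) (fill (drop (nmono_degree x) k) y)
  | Tri x y z =>
      Tri (fill k x) (fill (drop (nmono_degree x) k) y)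
          (fill (drop (nmono_degree x + nmono_degree y) k) z)
  end.

Lemma size_leaves m : size (leaves m) = nmono_degree m.
Proof. by elim: m => //= [x <- y <-|x <- y <- z <-]; rewrite !size_cat ?addnA. Qed.

Lemma drop_cat_le (T : Type) n (s1 s2 : seq T) :
  (n <= size s1)%N -> drop n (s1 ++ s2) = drop n s1 ++ s2.
Proof.
rewrite leq_eqVlt drop_cat => /predU1P[->|->] //.
by rewrite ltnn subnn drop0 drop_size.
Qed.

Lemma fill_cat k1 k2 m :
  (nmono_degree m <= size k1)%N -> fill (k1 ++ k2) m = fill k1 m.
Proof.
elim: m k1 => [i|x IHx y IHy|x IHx y IHy z IHz] k1 /=; first by case: k1.
  move=> le; have le1 := leq_trans (leq_addr _ _) le; rewrite IHx //.
  by rewrite drop_cat_le // IHy // size_drop leq_subRL.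
move=> le; have le2 := leq_trans (leq_addr _ _) le.
have le1 := leq_trans (leq_addr _ _) le2; rewrite IHx //.
by rewrite !drop_cat_le // IHy ?IHz // size_drop leq_subRL.
Qed.

Lemma fill_Bin k1 k2 x y : size k1 = nmono_degree x ->
  fill (k1 ++ k2) (Bin x y) = Bin (fill k1 x) (fill k2 y).
Proof. by move=> sz; rewrite /= fill_cat ?sz // drop_size_cat. Qed.

Lemma fill_Tri k1 k2 k3 x y z :
  size k1 = nmono_degree x -> size k2 = nmono_degree y ->
  fill (k1 ++ k2 ++ k3) (Tri x y z) = Tri (fill k1 x) (fill k2 y) (fill k3 z).
Proof.
move=> sz1 sz2; rewrite /= fill_cat ?sz1 // drop_size_cat // fill_cat ?sz2 //.
by rewrite addnC -drop_drop !drop_size_cat.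
Qed.

Lemma fill_leaves m : fill (leaves m) m = m.
Proof.
elim: m => [//|x IHx y IHy|x IHx y IHy z IHz].
  by rewrite fill_Bin ?size_leaves // IHx IHy.
by rewrite fill_Tri ?size_leaves // IHx IHy IHz.
Qed.

Lemma fill_fill k k' m : fill k (fill k' m) = fill k m.
Proof.
have deg_fill k1 m1 : nmono_degree (fill k1 m1) = nmono_degree m1.
  by elim: m1 k1 => //= [x IHx y IHy|x IHx y IHy z IHz] k1; rewrite ?IHx ?IHy ?IHz.
by elim: m k k' => [//|x IHx y IHy|x IHx y IHy z IHz] k k' /=;
  rewrite !deg_fill ?IHx ?IHy ?IHz.
Qed.

Fixpoint words (A : seq nat) (n : nat) : seq (seq nat) :=
  if n is n'.+1 then [seq a :: k | a <- A, k <- words A n'] else [:: [::]].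

Definition perms (n : nat) : seq (seq nat) :=
  [seq k <- words (iota 0 n) n | uniq k].

Lemma mem_words A n k :
  (k \in words A n) = (size k == n) && all (fun a => a \in A) k.
Proof.
elim: n k => [|n IHn] k; first by case: k.
apply/allpairsP/andP => [[[a u] /= [aA]]|[]].
  by rewrite IHn => /andP[/eqP<- uA] ->; rewrite /= aA.
case: k => // a u; rewrite eqSS => sz /= /andP[aA uA].
by exists (a, u); rewrite IHn sz.
Qed.

Lemma words_uniq A n : uniq A -> uniq (words A n).
Proof.
move=> uA; elim: n => //= n IHn; apply: allpairs_uniq => //.
by move=> [a u] [b v] _ _ [-> ->].
Qed.

Lemma big_words_add (V : nmodType) A n1 n2 (F : seq nat -> V) :
  \sum_(k <- words A (n1 + n2)) F k
  = \sum_(k1 <- words A n1) \sum_(k2 <- words A n2) F (k1 ++ k2).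
Proof.
elim: n1 F => [|n1 IHn] F; first by rewrite big_seq1.
rewrite addSn /= !big_allpairs_dep; apply: eq_bigr => a _ /=.
by rewrite IHn.
Qed.

(** All the bracketings of degree n, with variable 0 at the leaves; f bounds the
    recursion. *)
Fixpoint shapes (f n : nat) : seq nmono :=
  if f is f'.+1 then
    (if n == 1%N then [:: Var 0] else [::])
    ++ flatten [seq flatten [seq
         [seq Tri p.1 p.2 z | p <- [seq (x, y) | x <- shapes f' i,
                                                 y <- shapes f' j],
                              z <- shapes f' (n - (i + j))]
         | j <- iota 1 (n - i).-1] | i <- iota 1 n.-1]
    ++ flatten [seq [seq Bin x y | x <- shapes f' i, y <- shapes f' (n - i)]
         | i <- iota 1 n.-1]
  else [::].

Definition multilinear (n : nat) : seq nmono :=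
  let K := perms n in [seq fill k s | s <- shapes n n, k <- K].

Lemma mem_shapes m f : (nmono_degree m <= f)%N ->
  fill (nseq (nmono_degree m) 0%N) m \in shapes f (nmono_degree m).
Proof.
have drop0s (a b : nat) : drop a (nseq b 0%N) = nseq (b - a) 0%N.
  by elim: b a => [|b IHb] [|a] //=; rewrite IHb.
have fill0 m' k : (nmono_degree m' <= k)%N ->
    fill (nseq k 0%N) m' = fill (nseq (nmono_degree m') 0%N) m'.
  move=> /subnKC<-; rewrite nseqD fill_cat ?size_nseq //.
elim: m f => [i|x IHx y IHy|x IHx y IHy z IHz] [|f] //=.
- by have := nmono_degree_gt0 x; lia.
- move=> le; rewrite !mem_cat; apply/orP; right; apply/orP; right.
  have x0 := nmono_degree_gt0 x; have y0 := nmono_degree_gt0 y.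
  apply/flatten_mapP; exists (nmono_degree x); first by rewrite mem_iota; lia.
  rewrite drop0s fill0 ?leq_addr // addKn.
  by apply: allpairs_f; [apply: IHx; lia|apply: IHy; lia].
- by have := nmono_degree_gt0 x; lia.
- move=> le; rewrite !mem_cat; apply/orP; right; apply/orP; left.
  have x0 := nmono_degree_gt0 x; have y0 := nmono_degree_gt0 y.
  have z0 := nmono_degree_gt0 z.
  apply/flatten_mapP; exists (nmono_degree x); first by rewrite mem_iota; lia.
  apply/flatten_mapP; exists (nmono_degree y); first by rewrite mem_iota; lia.
  rewrite !drop0s fill0; last lia.
  rewrite fill0; last lia.
  rewrite addKn.
  set sx := fill _ x; set sy := fill _ y.
  rewrite -[Tri _ _ _]/((fun p z => Tri p.1 p.2 z) (sx, sy) _).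
  apply: allpairs_f; last by apply: IHz; lia.
  by apply: allpairs_f; [apply: IHx; lia|apply: IHy; lia].
Qed.

Lemma mem_multilinear n k m :
  k \in perms n -> nmono_degree m = n -> fill k m \in multilinear n.
Proof.
move=> kP deg_m; rewrite -(fill_fill k (nseq n 0%N)); apply: allpairs_f => //.
by rewrite -deg_m mem_shapes.
Qed.

(** * Weight vectors of V(6) *)

(** Position i stands for the weight vector v_(6 - 2i), so that the coefficients
    are indexed by natural numbers. *)
Definition wedge_term (i j : nat) (c : Z) := (i, j, c).

Definition alpha_list : seq (nat * nat * Z) :=
  [:: wedge_term 0 3 20; wedge_term 0 4 10; wedge_term 0 5 4;
      wedge_term 0 6 1;
      wedge_term 1 2 (-60); wedge_term 1 3 (-20); wedge_term 1 5 6;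
      wedge_term 1 6 4;
      wedge_term 2 3 (-20); wedge_term 2 4 (-15); wedge_term 2 6 10;
      wedge_term 3 4 (-20); wedge_term 3 5 (-20); wedge_term 3 6 20;
      wedge_term 4 5 (-60)].

Definition beta0_list : seq (nat * nat * Z) :=
  [:: wedge_term 0 5 2; wedge_term 0 6 1;
      wedge_term 1 4 (-10); wedge_term 1 5 (-4); wedge_term 1 6 2;
      wedge_term 2 3 20; wedge_term 2 4 5; wedge_term 2 5 (-10);
      wedge_term 3 4 20].

Definition wedge_coef (l : seq (nat * nat * Z)) (i j : nat) : Z :=
  foldr (fun t s =>
      Z.add (Z.sub (if eqn t.1.1 i && eqn t.1.2 j then t.2 else Z0)
                   (if eqn t.1.2 i && eqn t.1.1 j then t.2 else Z0)) s) Z0 l.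

Definition wedge_tab (l : seq (nat * nat * Z)) : seq (seq Z) :=
  [seq [seq wedge_coef l i j | j <- iota 0 7] | i <- iota 0 7].

Definition alpha_tab := Eval compute in wedge_tab alpha_list.
Definition beta0_tab := Eval compute in wedge_tab beta0_list.

(** Rows 5, 6 and 7 describe the action of u_2 = -E, u_0 = H and u_(-2) = F on
    the weight vectors: beta_0 of the vectors in positions i and j is a multiple
    of the element of weight 12 - 2 (i + j), hence row i + j is used. *)
Definition act_tab : seq (seq Z) :=
  nseq 5 [::] ++ [:: [:: 0; -6; -5; -4; -3; -2; -1];
                     [:: 6; 4; 2; 0; -2; -4; -6];
                     [:: 1; 2; 3; 4; 5; 6; 0]]%ZZ.

Definition entry (T : seq (seq Z)) (i j : nat) : Z := nth Z0 (nth [::] T i) j.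

Definition weight_br (x y : Z * nat) : Z * nat :=
  (Z.mul (Z.mul x.1 y.1) (entry alpha_tab x.2 y.2), (x.2 + y.2 - 3)%N).

Definition weight_tr (x y z : Z * nat) : Z * nat :=
  (Z.mul (Z.mul (Z.mul x.1 y.1) z.1)
     (Z.mul (Z.mul (-30)%ZZ (entry beta0_tab x.2 y.2))
            (entry act_tab (x.2 + y.2) z.2)),
   (x.2 + y.2 + z.2 - 6)%N).

(** Products of weight vectors are multiples of weight vectors: (c, i) stands for
    c v_(6 - 2i), and w lists the positions of the arguments. *)
Fixpoint weight_eval (w : seq nat) (m : nmono) : Z * nat :=
  match m with
  | Var i => (Zpos xH, nth 0%N w i)
  | Bin x y => weight_br (weight_eval w x) (weight_eval w y)
  | Tri x y z =>
      weight_tr (weight_eval w x) (weight_eval w y) (weight_eval w z)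
  end.

Section V6.

Variable K : numFieldType.
Local Notation V6 := (V6 K).
Local Notation ofZ := (ofZ K).

Definition weight_vec (i : nat) : V6 := vwt K (6 - 2 * i%:Z).

Lemma coordV6_linear w : linear (@coordV6 K w : V6 -> K^o).
Proof.
move=> a x y; rewrite /coordV6 scaler_sumr -big_split /=.
by apply: eq_bigr => i _; rewrite !mxE.
Qed.

Lemma wedge_map_skew (U : lmodType K) tb (x y : V6) :
  wedge_map tb x y = - wedge_map tb y x :> U.
Proof.
rewrite /wedge_map -sumrN; apply: eq_bigr => t _; rewrite -scaleNr.
by congr (_ *: _); rewrite /wedge_coord; ring.
Qed.

Lemma wedge_map_bilin (U : lmodType K) (tb : seq (int * int * U)) :
  (forall y, linear (wedge_map tb ^~ y)) /\ (forall x, linear (wedge_map tb x)).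
Proof.
have linl y : linear (wedge_map tb ^~ y).
  move=> a x x'; rewrite /wedge_map scaler_sumr -big_split.
  apply: eq_bigr => t _ /=.
  rewrite scalerA -scalerDl /wedge_coord !coordV6_linear; congr (_ *: _).
  by rewrite /GRing.scale /=; ring.
by split=> // x a y y'; rewrite !(wedge_map_skew _ x) linl opprD scalerN.
Qed.

Lemma alpha_bilin : bilin (@alpha K).
Proof. exact: wedge_map_bilin. Qed.

Lemma alpha_skew (x y : V6) : alpha x y = - alpha y x.
Proof. exact: wedge_map_skew. Qed.

Lemma addrACA3 (V : zmodType) (x y z x' y' z' : V) :
  x + x' + (y + y') + (z + z') = x + y + z + (x' + y' + z').
Proof. by rewrite (addrACA x) (addrACA (x + y)). Qed.

Lemma sl2_act_linear_r X : linear (@sl2_act K X).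
Proof.
have actL (f : 'I_7 -> V6) : linear (fun x : V6 => \sum_(i < 7) x 0 i *: f i).
  move=> a x y; rewrite scaler_sumr -big_split; apply: eq_bigr => i _ /=.
  by rewrite !mxE scalerDl scalerA.
move=> a x y; rewrite /sl2_act /actE /actF /actH !actL.
rewrite !scalerDr !scalerA ![_ * a]mulrC; exact: addrACA3.
Qed.

Lemma sl2_act_linear_l x : linear (@sl2_act K ^~ x).
Proof.
move=> a X Y; rewrite /sl2_act !mxE !scalerDl !scalerDr !scalerA.
exact: addrACA3.
Qed.

Lemma beta_act_trilin : trilinear (@beta_act K).
Proof.
have [linl linr] := wedge_map_bilin (beta0_table K).
split=> [y z|x z|x y] a u v; rewrite /beta_act /beta.
- by rewrite linl scalerDr scalerA mulrC -scalerA sl2_act_linear_l.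
- by rewrite linr scalerDr scalerA mulrC -scalerA sl2_act_linear_l.
- exact: sl2_act_linear_r.
Qed.

Lemma beta_act_skew (x y z : V6) : beta_act x y z = - beta_act y x z.
Proof.
rewrite /beta_act /beta wedge_map_skew scalerN -scaleN1r.
by rewrite (linear_scale _ _ (sl2_act_linear_l z)) scaleN1r.
Qed.

Lemma wt_eq (i : 'I_7) (j : nat) : (wt i == 6 - 2 * j%:Z) = (i == j :> nat).
Proof. by rewrite /wt; lia. Qed.

Lemma weight_vecE j (i : 'I_7) : weight_vec j 0 i = (i == j :> nat)%:R.
Proof. by rewrite mxE wt_eq. Qed.

Lemma coordV6_weight_vec (a j : nat) : (a < 7)%N ->
  coordV6 (6 - 2 * a%:Z) (weight_vec j) = (a == j)%:R.
Proof.
move=> lt_a; rewrite /coordV6 (big_pred1 (Ordinal lt_a)) ?weight_vecE // => i.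
by rewrite wt_eq.
Qed.

Lemma wedge_map_weight (U : lmodType K) (l : seq (nat * nat * Z))
    (u : nat -> U) i j :
  all (fun t => (t.1.1 < 7) && (t.1.2 < 7))%N l ->
  wedge_map [seq (6 - 2 * t.1.1%:Z, 6 - 2 * t.1.2%:Z,
                  ofZ t.2 *: u (t.1.1 + t.1.2)%N) | t <- l]
            (weight_vec i) (weight_vec j)
  = ofZ (wedge_coef l i j) *: u (i + j)%N.
Proof.
rewrite /wedge_map big_map.
elim: l => [|[[a b] c] l IHl] /=; first by rewrite big_nil scale0r.
case/andP=> /andP[lt_a lt_b] /IHl {}IHl.
rewrite big_cons IHl ofZD [RHS]scalerDl; congr (_ + _).
have coefE x y : ((a == x) && (b == y))%:R *: (ofZ c *: u (a + b)%N)
    = ofZ (if eqn a x && eqn b y then c else Z0) *: u (x + y)%N.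
  rewrite -[eqn a x]/(a == x) -[eqn b y]/(b == y).
  by case: andP => [[/eqP-> /eqP->]|_]; rewrite ?scale1r // !scale0r.
rewrite /wedge_coord /= !coordV6_weight_vec // -!natrM !mulnb.
rewrite ofZD ofZN !scalerBl coefE [(b == i) && _]andbC coefE.
by rewrite [(j + i)%N]addnC [eqn a j && _]andbC.
Qed.

Lemma alpha_tableE : alpha_table K
  = [seq (6 - 2 * t.1.1%:Z, 6 - 2 * t.1.2%:Z,
          ofZ t.2 *: weight_vec (t.1.1 + t.1.2 - 3)) | t <- alpha_list].
Proof. by rewrite /= [ofZ 1 *: _]scale1r. Qed.

Definition u_vec (s : nat) : 'M[K]_2 :=
  match s with 5 => u2 K | 6 => u0 K | 7 => um2 K | _ => 0 end.

Lemma beta0_tableE : beta0_table K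
  = [seq (6 - 2 * t.1.1%:Z, 6 - 2 * t.1.2%:Z,
          ofZ t.2 *: u_vec (t.1.1 + t.1.2)) | t <- beta0_list].
Proof. by rewrite /= [ofZ 1 *: _]scale1r. Qed.

Lemma entry_wedge_tab l i j : (i < 7)%N -> (j < 7)%N ->
  entry (wedge_tab l) i j = wedge_coef l i j.
Proof.
move=> lt_i lt_j; rewrite /entry (nth_map 0%N) ?size_iota //.
by rewrite (nth_map 0%N) ?size_iota // !nth_iota.
Qed.

Lemma alpha_weight i j : (i < 7)%N -> (j < 7)%N ->
  alpha (weight_vec i) (weight_vec j)
  = ofZ (entry alpha_tab i j) *: weight_vec (i + j - 3).
Proof.
move=> lt_i lt_j; rewrite /alpha alpha_tableE.
rewrite -[alpha_tab]/(wedge_tab alpha_list) entry_wedge_tab //.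
exact: (@wedge_map_weight _ _ (fun s => weight_vec (s - 3))).
Qed.

Lemma sum_weight_vec (f : 'I_7 -> V6) (k : 'I_7) :
  \sum_(i < 7) weight_vec k 0 i *: f i = f k.
Proof.
rewrite (bigD1 k) //= weight_vecE eqxx scale1r big1 ?addr0 // => i /negPf ik.
by rewrite weight_vecE -[i == k :> nat]/(i == k) ik scale0r.
Qed.

Lemma sl2_act_weight s k : (k < 7)%N ->
  sl2_act (u_vec s) (weight_vec k)
  = ofZ (entry act_tab s k) *: weight_vec (s + k - 6).
Proof.
move=> lt_k; pose k' := Ordinal lt_k; rewrite /sl2_act /actE /actF /actH.
rewrite -[weight_vec k]/(weight_vec k') !sum_weight_vec /=.
have vwt_out w : (w == 8) || (w == -8) -> vwt K w = 0.
  move=> w8; apply/rowP => -[i lt_i]; rewrite !mxE.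
  by case: eqP => // wi; move: w8; rewrite -wi /wt /=; lia.
case: s => [|[|[|[|[|[|[|[|s]]]]]]]];
  rewrite !mxE /= ?(oppr0, subr0) ?(scale0r, add0r, addr0).
1-5,9: by rewrite /entry /= ?nth_nil ofZ0 scale0r.
- rewrite scaleN1r -scaleNr; case: k lt_k @k' => [|k] lt_k k'; last first.
    by case: k lt_k @k' => [|[|[|[|[|[|k]]]]]].
  by rewrite vwt_out // scaler0 ofZ0 scale0r.
- rewrite scale1r.
  by case: k lt_k @k' => [|[|[|[|[|[|[|k]]]]]]].
- rewrite scale1r; have [k6|] := eqVneq k 6%N; last first.
    by case: k lt_k @k' => [|[|[|[|[|[|[|k]]]]]]].
  by rewrite vwt_out ?scaler0 /wt /= k6 // ofZ0 scale0r.
Qed.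

Lemma beta_act_weight i j k : (i < 7)%N -> (j < 7)%N -> (k < 7)%N ->
  beta_act (weight_vec i) (weight_vec j) (weight_vec k)
  = ofZ (Z.mul (Z.mul (-30)%ZZ (entry beta0_tab i j)) (entry act_tab (i + j) k))
    *: weight_vec (i + j + k - 6).
Proof.
move=> lt_i lt_j lt_k; rewrite /beta_act /beta beta0_tableE.
rewrite -[beta0_tab]/(wedge_tab beta0_list) entry_wedge_tab // wedge_map_weight //.
rewrite !(linear_scale _ _ (sl2_act_linear_l _)) sl2_act_weight //.
by rewrite !scalerA !ofZM.
Qed.

(** Positions beyond 6 can only occur with coefficient 0, because the tables have
    zeros there. *)
Lemma weight_evalP w m (q := weight_eval w m) : all (gtn 7) w ->
  nmono_eval (@alpha K) (@beta_act K) (fun i => weight_vec (nth 0%N w i)) m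
    = ofZ q.1 *: weight_vec q.2
  /\ (q.1 == Z0) || (q.2 < 7)%N.
Proof.
rewrite {}/q => w7.
have [br1 br2] := alpha_bilin; have [tr1 tr2 tr3] := beta_act_trilin.
have linZ := @linear_scale K V6 V6.
elim: m => [i|x [IHx x7] y [IHy y7]|x [IHx x7] y [IHy y7] z [IHz z7]] /=.
- rewrite scale1r; split=> //.
  have [lt|le] := ltnP i (size w); last by rewrite nth_default.
  by have /allP/(_ _ (mem_nth 0%N lt)) := w7.
- move: (weight_eval w x) (weight_eval w y) x7 y7 IHx IHy.
  move=> [a i] [b j] /= i7 j7 -> ->.
  rewrite (linZ _ _ _ (br1 _)) (linZ _ _ _ (br2 _)) scalerA -ofZM.
  case/predU1P: i7 => [->|i7]; first by rewrite ofZ0 !scale0r.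
  case/predU1P: j7 => [->|j7]; first by rewrite !Z.mul_0_r ofZ0 !scale0r.
  rewrite alpha_weight // !scalerA -ofZM; split=> //.
  have : all (fun i => all (fun j => Z.eqb (entry alpha_tab i j) Z0
      || (i + j - 3 < 7)%N) (iota 0 7)) (iota 0 7) by [].
  move/allP/(_ i); rewrite mem_iota i7 => /(_ isT)/allP/(_ j).
  rewrite mem_iota j7 => /(_ isT).
  by case: Z.eqb_spec => [->|_ /= ->]; rewrite ?Z.mul_0_r ?orbT.
- move: (weight_eval w x) (weight_eval w y) (weight_eval w z) x7 y7 z7 IHx IHy IHz.
  move=> [a i] [b j] [c k] /= i7 j7 k7 -> -> ->.
  rewrite (linZ _ _ _ (tr1 _ _)) (linZ _ _ _ (tr2 _ _)) (linZ _ _ _ (tr3 _ _)).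
  rewrite !scalerA -!ofZM.
  case/predU1P: i7 => [->|i7]; first by rewrite ofZ0 !scale0r.
  case/predU1P: j7 => [->|j7]; first by rewrite !Z.mul_0_r ofZ0 !scale0r.
  case/predU1P: k7 => [->|k7]; first by rewrite !Z.mul_0_r ofZ0 !scale0r.
  rewrite beta_act_weight // !scalerA -ofZM.
  split; first by rewrite Z.mul_assoc.
  have : all (fun i => all (fun j => all (fun k =>
      Z.eqb (Z.mul (entry beta0_tab i j) (entry act_tab (i + j) k)) Z0
      || (i + j + k - 6 < 7)%N) (iota 0 7)) (iota 0 7)) (iota 0 7) by [].
  move/allP/(_ i); rewrite mem_iota i7 => /(_ isT)/allP/(_ j).
  rewrite mem_iota j7 => /(_ isT)/allP/(_ k); rewrite mem_iota k7 => /(_ isT).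
  rewrite -(Z.mul_assoc (-30)).
  by case: Z.eqb_spec => [->|_ /= ->]; rewrite ?Z.mul_0_r ?orbT.
Qed.

(** A monomial sends weight vectors to a multiple of a single weight vector; the
    sum of the coordinates extracts the factor, whichever the vector is. *)
Definition coord_sum (x : V6) : K := \sum_i x 0 i.

Lemma coord_sum_linear : linear (coord_sum : V6 -> K^o).
Proof.
move=> a x y; rewrite /coord_sum scaler_sumr -big_split /=.
by apply: eq_bigr => i _; rewrite !mxE.
Qed.

Lemma coord_sum_eval w m : all (gtn 7) w ->
  coord_sum (nmono_eval (@alpha K) (@beta_act K)
               (fun i => weight_vec (nth 0%N w i)) m)
  = ofZ (weight_eval w m).1.
Proof.
move=> /(weight_evalP m)[-> /orP[/eqP->|lt7]].
  by rewrite scale0r /coord_sum big1 // => i _; rewrite mxE.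
rewrite /coord_sum (bigD1 (Ordinal lt7)) //= big1 => [|i /negPf ne].
  by rewrite mxE weight_vecE eqxx mulr1 addr0.
by rewrite mxE weight_vecE -[_ == _ :> nat]/(i == Ordinal lt7) ne mulr0.
Qed.

End V6.

Lemma weight_eval_norm (K : numFieldType) w m : all (gtn 7) w ->
  ofZ K (weight_eval w m).1
  = (-1) ^+ (skew_norm m).1 * ofZ K (weight_eval w (skew_norm m).2).1.
Proof.
move=> w7; rewrite -!coord_sum_eval //.
rewrite (ev_skew_norm (@alpha_bilin K) (@beta_act_trilin K) (@alpha_skew K)
           (@beta_act_skew K)).
exact: (linear_scale _ _ (@coord_sum_linear K)).
Qed.

(** * The certificates *)

Definition relation (n : nat) (l : nat * seq nat) : zpoly :=
  zpoly_norm (zmap (subst (fun j => Var (nth 0%N l.2 j)))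
                   (nth [::] (gens n) l.1)).

Fixpoint add_at (i : nat) (c : Z) (v : seq Z) : seq Z :=
  match v, i with
  | [::], _ => [::]
  | x :: v', 0 => Z.add c x :: v'
  | x :: v', i'.+1 => x :: add_at i' c v'
  end.

Definition coords (P : seq nmono) (r : zpoly) : seq Z :=
  foldr (fun t v => add_at (find (eqnm t.2) P) t.1 v) (nseq (size P) Z0) r.

Definition phi (ws : seq (seq nat)) (m : nmono) : seq Z :=
  [seq (weight_eval w m).1 | w <- ws].

(** With phi for row, the values of the chosen functionals on r. *)
Definition lincomb (row : nmono -> seq Z) (r : zpoly) : seq Z :=
  foldr (fun t acc => comb t.1 (row t.2) (Zpos xH) acc) [::] r.

(** Labels of the chosen relations, the splitting of the normal monomials into P
    and N, and the chosen words of positions. *)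
Record certificate := Certificate {
  cert_relations : seq (nat * seq nat);
  cert_P : seq nmono;
  cert_N : seq nmono;
  cert_words : seq (seq nat) }.

Definition check (n : nat) (c : certificate) : bool :=
  let: Certificate ls P N ws := c in
  let R := [seq relation n l | l <- ls] in
  let B := P ++ N in
  let T := [seq phi ws m | m <- B] in
  [&& all (all (gtn 7)) ws, size ws == size N,
      all (fun m => memm (skew_norm m).2 B) (multilinear n),
      all (all (fun t => memm t.2 B)) R,
      all (fun r => all (Z.eqb Z0)
             (lincomb (fun m => nth [::] T (find (eqnm m) B)) r)) R,
      lu (size P) [seq coords P r | r <- R]
    & lu (size N) [seq phi ws m | m <- N]].

(** Row echelon form built up row by row: entry j of the list is the remainder,
    from column j on, of the pivot row of that column.  The result gives the pivot
    column of the new row, unless the row is dependent on the previous ones. *)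
Fixpoint insert (S : seq (option (seq Z))) (v : seq Z) :
    option (nat * seq (option (seq Z))) :=
  match S, v with
  | None :: S', Z0 :: v' =>
      if insert S' v' is Some (j, S'') then Some (j.+1, None :: S'') else None
  | None :: S', _ :: _ => Some (0%N, Some v :: S')
  | (Some (c :: r) as p) :: S', _ :: _ =>
      if insert S' (clear_head c r v) is Some (j, S'')
      then Some (j.+1, p :: S'') else None
  | _, _ => None
  end.

Definition pivots (T : Type) (n : nat) (V : seq (T * seq Z)) : seq (T * nat) :=
  rev (foldl (fun st tv =>
                if insert st.1 tv.2 is Some (j, S') then (S', (tv.1, j) :: st.2)
                else st)
             (nseq n None, [::]) V).2.

Definition normal_monomials (n : nat) : seq nmono :=
  rev (foldl (fun acc m => let m' := (skew_norm m).2 in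
                           if memm m' acc then acc else m' :: acc)
             [::] (multilinear n)).

(** A nonzero homomorphism from the n-th tensor power of V(6) to V(6) is onto,
    hence its component on v_4 does not vanish on all tensors of weight vectors of
    total weight 4.  So words of this weight suffice; the elimination stays
    small for it. *)
Definition weight4_words (n : nat) : seq (seq nat) :=
  [seq w <- words (iota 0 7) n | sumn w == (3 * n - 2)%N].

(** Sparse rows are offered first, so that they become pivots; the pivot columns
    of the relations form P, and the monomials left over form N.  The reversal of
    the order on N only serves to keep the second elimination small. *)
Definition find_certificate (n : nat) : certificate :=
  let B := normal_monomials n in
  let K := perms n in
  let R := [seq (l, relation n l) | l <-
             [seq (i, k) | i <- iota 0 (size (gens n)), k <- K]] in
  let R' := sort (fun x y => (size x.2 <= size y.2)%N) R in
  let p := pivots (size B) [seq (x.1, coords B x.2) | x <- R'] in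
  let P := [seq nth (Var 0) B x.2 | x <- p] in
  let N := [seq m <- rev B | ~~ memm m P] in
  let V := [seq (w, [seq (weight_eval w m).1 | m <- N])
             | w <- weight4_words n] in
  let nonzeros (x : seq nat * seq Z) := count (fun c => ~~ Z.eqb c Z0) x.2 in
  let V' := sort (fun x y => (nonzeros x <= nonzeros y)%N) V in
  let q := pivots (size N) V' in
  Certificate [seq x.1 | x <- p] P
              [seq nth (Var 0) N x.2 | x <- q] [seq x.1 | x <- q].

Definition cert1 := Eval vm_compute in find_certificate 1.
Definition cert2 := Eval vm_compute in find_certificate 2.
Definition cert3 := Eval vm_compute in find_certificate 3.
Definition cert4 := Eval vm_compute in find_certificate 4.
Definition cert5 := Eval vm_compute in find_certificate 5.

Definition cert (n : nat) : certificate :=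
  match n with 1 => cert1 | 2 => cert2 | 3 => cert3 | 4 => cert4 | _ => cert5 end.

Lemma check_cert n : (0 < n <= 5)%N -> check n (cert n).
Proof.
move=> n5; have /allP : all (fun n => check n (cert n)) (iota 1 5) by vm_compute.
by apply; rewrite mem_iota.
Qed.

Section Reconstruction.

Variables (K : numFieldType) (W : lmodType K).
Variables (br : W -> W -> W) (tr : W -> W -> W -> W).
Hypothesis br_bilin : bilin br.
Hypothesis tr_trilin : trilinear tr.
Hypothesis ids : forall r, r \in identitiesZ -> holds br tr r.
Local Notation ev := (nmono_eval br tr).
Local Notation ofZ := (ofZ K).

Lemma br_skew x y : br x y = - br y x.
Proof.
have := ids (mem_head _ _) (fun i => if i is 0 then x else y).
by rewrite /zeval big_cons big_seq1 /= !scale1r => /eqP; rewrite addr_eq0 => /eqP.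
Qed.

Lemma tr_skew x y z : tr x y z = - tr y x z.
Proof.
have mem_skew : skew_symmetryZ \in identitiesZ by rewrite in_cons mem_head orbT.
have := ids mem_skew (fun i => match i with 0 => x | 1 => y | _ => z end).
by rewrite /zeval big_cons big_seq1 /= !scale1r => /eqP; rewrite addr_eq0 => /eqP.
Qed.

Lemma holds_relation n l : holds br tr (relation n l).
Proof.
move=> e; rewrite (zeval_norm br_bilin tr_trilin br_skew tr_skew).
apply: holds_subst; have [lt|le] := ltnP l.1 (size (gens n)).
  by apply: holds_gens (mem_nth _ lt).
by rewrite nth_default // => e'; rewrite /zeval big_nil.
Qed.

Lemma dot_phi ws (g : seq W) m : size g = size ws ->
  dot (phi ws m) g
  = \sum_(i < size ws) ofZ (weight_eval (nth [::] ws i) m).1 *: nth 0 g i.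
Proof.
move=> sz_g; rewrite dotE sz_g; apply: eq_bigr => i _.
by rewrite (nth_map [::]).
Qed.

Lemma dot_lincomb row r (x : seq W) :
  dot (lincomb row r) x = \sum_(t <- r) ofZ t.1 *: dot (row t.2) x.
Proof.
elim: r => [|t r IHr]; first by rewrite big_nil.
by rewrite big_cons /= dot_comb IHr scale1r.
Qed.

Lemma dot_add_at i c v (x : seq W) : size v = size x ->
  dot (add_at i c v) x = ofZ c *: nth 0 x i + dot v x.
Proof.
elim: v i x => [|b v IHv] [|i] [|u x] //=; rewrite ?scaler0 ?add0r // => -[sz].
  by rewrite ofZD scalerDl addrA.
by rewrite IHv // addrCA.
Qed.

Lemma dot_coords P r (f : nmono -> W) :
  dot (coords P r) (map f P)
  = \sum_(t <- r) (if memm t.2 P then ofZ t.1 *: f t.2 else 0).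
Proof.
have size_add_at i c v : size (add_at i c v) = size v.
  by elim: v i => [|b v IHv] [|i] //=; rewrite IHv.
have size_coords r' : size (coords P r') = size P.
  by elim: r' => [|t r' IHr] /=; rewrite ?size_nseq // size_add_at.
elim: r => [|t r IHr]; rewrite ?big_nil ?big_cons /=.
  by rewrite dotE big1 // => i _; rewrite nth_nseq if_same ofZ0 scale0r.
rewrite dot_add_at ?size_coords ?size_map // IHr; congr (_ + _).
case: ifPn => [mP|nP].
  rewrite (nth_map (Var 0)) -?has_find //.
  by rewrite -(elimT (eqnmP _ _) (nth_find (Var 0) mP)).
by rewrite nth_default ?scaler0 // size_map leqNgt -has_find.
Qed.

(** The elements g are found by solving the equations for the monomials of N.  The
    defect d of the formula then vanishes on N and satisfies the chosen relations,
    because the words annihilate them; so it vanishes on P. *)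
Lemma reconstruction n c y : check n c ->
  exists2 g : seq W, size g = size (cert_words c)
    & forall m, m \in multilinear n -> ev y m = dot (phi (cert_words c) m) g.
Proof.
case: c => ls P N ws /=; set B := P ++ N.
case/and5P=> /allP ws7 /eqP sz_ws /allP complete /allP cover.
case/and3P=> /allP vanish luP luN.
have [||g sz_g Eg] := lu_solve (y := [seq ev y m | m <- N]) luN;
  rewrite ?size_map //.
rewrite -sz_ws in sz_g; exists g => //.
pose d m := ev y m - dot (phi ws m) g.
have dN m : m \in N -> d m = 0.
  move=> mN; move: Eg; rewrite -map_comp => /eq_in_map/(_ m mN) /= Em.
  by rewrite /d -Em subrr.
have d_rel r : r \in [seq relation n l | l <- ls] ->
    \sum_(t <- r) ofZ t.1 *: d t.2 = 0.
  move=> rR; under eq_bigr do rewrite scalerBr; rewrite sumrB.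
  have -> : \sum_(t <- r) ofZ t.1 *: ev y t.2 = 0.
    by case/mapP: rR => l _ ->; apply: holds_relation.
  pose row m := nth [::] [seq phi ws m' | m' <- B] (find (eqnm m) B).
  have rowE t : t \in r -> row t.2 = phi ws t.2.
    move=> t_r; have mB := allP (cover _ rR) _ t_r.
    rewrite /row (nth_map (Var 0)) -?has_find //.
    by rewrite -(elimT (eqnmP _ _) (nth_find (Var 0) mB)).
  rewrite (eq_big_seq (fun t => ofZ t.1 *: dot (row t.2) g)) => [|t /rowE-> //].
  rewrite -dot_lincomb dotE big1 ?subr0 // => i _; set v := lincomb _ _.
  have -> : nth Z0 v i = Z0; last by rewrite ofZ0 scale0r.
  have [lt|le] := ltnP i (size v); last by rewrite nth_default.
  by have /Z.eqb_spec := allP (vanish _ rR) _ (mem_nth Z0 lt).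
have dP m : m \in P -> d m = 0.
  move=> mP; apply: (lu_inj luP _ _ (map_f d mP)); first by rewrite size_map.
  move=> _ /mapP[r rR ->]; rewrite dot_coords -[RHS](d_rel r rR).
  apply: eq_big_seq => t t_r; case: ifPn => // nP.
  have := allP (cover _ rR) _ t_r; rewrite !memmE mem_cat in nP *.
  by rewrite (negPf nP) => /dN->; rewrite scaler0.
move=> m /complete; rewrite memmE => mB.
have /eqP : d (skew_norm m).2 = 0.
  by move: mB; rewrite mem_cat => /orP[/dP|/dN].
rewrite subr_eq0 => /eqP Em.
rewrite (ev_skew_norm br_bilin tr_trilin br_skew tr_skew) Em !dot_phi //.
rewrite scaler_sumr; apply: eq_bigr => i _.
by rewrite scalerA [in RHS]weight_eval_norm // ws7 ?mem_nth.
Qed.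

End Reconstruction.

(** * Polarization *)

Section Polarization.

Variables (K : numFieldType) (U : lmodType K).
Variables (br : U -> U -> U) (tr : U -> U -> U -> U).
Hypothesis br_bilin : bilin br.
Hypothesis tr_trilin : trilinear tr.
Local Notation ev := (nmono_eval br tr).

Lemma ev_sum (A : seq nat) (a : nat -> nat -> K) (x : nat -> U) m :
  ev (fun i => \sum_(j <- A) a i j *: x j) m
  = \sum_(k <- words A (nmono_degree m))
      (\prod_(t <- zip (leaves m) k) a t.1 t.2) *: ev x (fill k m).
Proof.
case: br_bilin tr_trilin => br1 br2 [tr1 tr2 tr3].
elim: m => [i|y IHy z IHz|y IHy z IHz t IHt].
- rewrite [RHS]big_allpairs_dep; apply: eq_bigr => j _.
  by rewrite big_seq1 /= big_seq1.
- rewrite [LHS]/= IHy IHz (linear_comb _ _ _ (br1 _)) [RHS]big_words_add.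
  apply: eq_big_seq => k1; rewrite mem_words => /andP[/eqP sz1 _].
  rewrite (linear_comb _ _ _ (br2 _)) scaler_sumr.
  apply: eq_bigr => k2 _.
  rewrite fill_Bin //= zip_cat ?size_leaves // big_cat.
  by rewrite scalerA.
- rewrite [LHS]/= IHy IHz IHt (linear_comb _ _ _ (tr1 _ _)).
  rewrite [nmono_degree (Tri _ _ _)]/= -addnA [RHS]big_words_add.
  apply: eq_big_seq => k1; rewrite mem_words => /andP[/eqP sz1 _].
  rewrite (linear_comb _ _ _ (tr2 _ _)) scaler_sumr [RHS]big_words_add.
  apply: eq_big_seq => k2; rewrite mem_words => /andP[/eqP sz2 _].
  rewrite (linear_comb _ _ _ (tr3 _ _)) !scaler_sumr.
  apply: eq_bigr => k3 _.
  rewrite fill_Tri //= !zip_cat ?size_leaves // !big_cat.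
  by rewrite !scalerA -mulrA.
Qed.

(** The polarization of the component of sum_m c_m m whose variables are, with
    multiplicity, the entries of w: each occurrence of the variable w_j is
    replaced by x_j for some j, in all the ways that use every j once. *)
Definition polar (n : nat) (L : seq nmono) (c : nmono -> K) (w : seq nat)
    (x : nat -> U) : U :=
  \sum_(m <- L) c m *:
    \sum_(k <- perms n | map (nth 0%N w) k == leaves m) ev x (fill k m).

(** Inclusion-exclusion: the value of the variable i is taken to be the sum of
    the x_j with j in S and w_j = i, and the results are added over all S with
    the sign of #|S|.  In the expansion only the words k that contain every
    j < n survive, that is, the permutations. *)
Lemma polar_eq0 n L c w x : all (fun m => nmono_degree m == n) L ->
  (forall e, \sum_(m <- L) c m *: ev e m = 0) -> polar n L c w x = 0.
Proof.
move=> /allP L_n L0.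
pose inS (S : {set 'I_n}) (j : nat) := j \in map val (enum S).
pose a S i j : K := (inS S j && (nth 0%N w j == i))%:R.
pose e S i := \sum_(j <- iota 0 n) a S i j *: x j.
have prodE S m k : size k = size m ->
    \prod_(t <- zip m k) a S t.1 t.2
    = (all (inS S) k && (map (nth 0%N w) k == m))%:R.
  elim: k m => [|j k IHk] [|i m] //=; first by rewrite big_nil.
  move=> [/IHk]; rewrite big_cons => -> /=; rewrite -natrM mulnb eqseq_cons.
  by congr (nat_of_bool _)%:R; rewrite andbACA.
have altE k : k \in words (iota 0 n) n ->
    \sum_(S : {set 'I_n}) (-1) ^+ #|S| * (all (inS S) k)%:R
    = (-1) ^+ n * (uniq k)%:R :> K.
  rewrite mem_words => /andP[/eqP sz_k /allP k_n].
  (* The sum over S factors: j contributes -1 if it is in S, and otherwise 1 or 0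
     according as j is absent from k or not. *)
  transitivity (\sum_(S : {set 'I_n}) \prod_(j < n)
      (if j \in S then -1 else (val j \notin k)%:R) : K).
    apply: eq_bigr => S _; rewrite (bigID [in S]) /=.
    rewrite (eq_bigr (fun=> -1)) => [|j ->//]; rewrite prodr_const.
    congr (_ * _); rewrite (eq_bigr (fun j : 'I_n => (val j \notin k)%:R));
      last by move=> j /negPf->.
    have [/allP kS|/allPn[j jk jS]] := boolP (all _ _).
      rewrite big1 // => j jS; case: (boolP (val j \in k)) => // /kS.
      by rewrite /inS mem_map ?mem_enum; [rewrite (negPf jS)|exact: val_inj].
    have lt_j : (j < n)%N by have := k_n _ jk; rewrite mem_iota.
    rewrite (bigD1 (Ordinal lt_j)) /= ?jk ?mul0r //.
    apply: contra jS => jS; rewrite /inS -[j]/(val (Ordinal lt_j)).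
    by rewrite map_f ?mem_enum.
  rewrite -bigA_distr.
  have [uk|nuk] := boolP (uniq k).
    have [|_ Ek] := uniq_min_size uk k_n; first by rewrite size_iota sz_k.
    rewrite (eq_bigr (fun=> -1)) => [|j _].
      by rewrite prodr_const card_ord mulr1.
    by rewrite Ek mem_iota /= ltn_ord addr0.
  rewrite mulr0; have [j jk] : exists j : 'I_n, val j \notin k.
    apply/existsP; apply: contraR nuk => /existsPn k_full.
    apply: (@leq_size_uniq _ (iota 0 n));
      rewrite ?iota_uniq ?size_iota ?sz_k // => i.
    rewrite mem_iota /= => lt_i.
    by have := k_full (Ordinal lt_i); rewrite negbK.
  by rewrite (bigD1 j) //= jk addNr mul0r.
have: \sum_(S : {set 'I_n}) (-1) ^+ #|S| *:
        \sum_(m <- L) c m *: ev (e S) m = 0.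
  by rewrite big1 // => S _; rewrite L0 scaler0.
under eq_bigr do rewrite scaler_sumr; rewrite exchange_big /= => sum0.
apply: (scalerI (_ : (-1) ^+ n != 0 :> K)); first by rewrite signr_eq0.
rewrite scaler0 -[RHS]sum0 scaler_sumr; apply: eq_big_seq => m mL.
have deg_m := eqP (L_n _ mL).
under [RHS]eq_bigr => S _ do
  rewrite scalerA mulrC -scalerA ev_sum scaler_sumr deg_m.
rewrite -scaler_sumr scalerA mulrC -scalerA; congr (_ *: _).
rewrite exchange_big /= scaler_sumr /perms big_filter_cond big_mkcond /=.
apply: eq_big_seq => k kW.
have [/eqP sz_k _] := andP (etrans (esym (mem_words _ _ _)) kW).
under eq_bigr => S _ do
  rewrite scalerA prodE ?size_leaves ?sz_k ?deg_m // -mulnb natrM mulrA.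
rewrite -scaler_suml -mulr_suml altE // -mulrA -natrM mulnb -scalerA.
by case: ifP; rewrite ?scale1r // scale0r scaler0.
Qed.

Lemma map_nth_perm_eq n (w u k : seq nat) : size w = n -> size u = n ->
  k \in perms n ->
  (map (nth 0%N w) k == u)
  = (w == map (fun i => nth 0%N u (index i k)) (iota 0 n)).
Proof.
rewrite mem_filter mem_words => sz_w sz_u /andP[uk /andP[/eqP sz_k /allP k_n]].
have mem_k i : (i < n)%N -> i \in k.
  have /(_ uk k_n) [|_ ->] := @uniq_min_size _ k (iota 0 n).
    by rewrite size_iota sz_k.
  by rewrite mem_iota.
apply/eqP/eqP => [<-|->]; apply: (@eq_from_nth _ 0%N).
- by rewrite size_map size_iota.
- move=> i; rewrite sz_w => lt_i.
  rewrite (nth_map 0%N) ?size_iota // nth_iota // add0n.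
  by rewrite (nth_map 0%N) ?index_mem ?mem_k // nth_index ?mem_k.
- by rewrite size_map sz_k.
- move=> i; rewrite size_map sz_k => lt_i; rewrite (nth_map 0%N) ?sz_k //.
  have lt_ki : (nth 0%N k i < n)%N.
    have := k_n _ (mem_nth 0%N (_ : (i < size k)%N)).
    by rewrite sz_k mem_iota; apply.
  rewrite (nth_map 0%N) ?size_iota // nth_iota // add0n index_uniq ?sz_k //.
Qed.

(** Putting x_j = e(w_j) turns each term of the polarization back into e(m).
    Summing over all words w avoids counting the permutations that fix a word: for
    each m and each permutation exactly one w contributes. *)
Lemma sum_polar n M L c e : all (fun m => nmono_degree m == n) L ->
  all (fun m => all (gtn M) (leaves m)) L ->
  \sum_(w <- words (iota 0 M) n) polar n L c w (fun i => e (nth 0%N w i))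
  = (size (perms n))%:R *: \sum_(m <- L) c m *: ev e m.
Proof.
move=> /allP L_n /allP L_M; rewrite exchange_big scaler_sumr /=.
apply: eq_big_seq => m mL; have deg_m := eqP (L_n _ mL).
rewrite -scaler_sumr scalerA mulrC -scalerA; congr (_ *: _).
have ev_fill (f : nat -> nat) k m' : (nmono_degree m' <= size k)%N ->
    ev (fun i => e (f i)) (fill k m') = ev e (fill (map f k) m').
  elim: m' k => [i|y IHy z IHz|y IHy z IHz t IHt] k /=; first by case: k.
    move=> le; have le1 := leq_trans (leq_addr _ _) le.
    by rewrite IHy // IHz ?map_drop // size_drop leq_subRL.
  move=> le; have le2 := leq_trans (leq_addr _ _) le.
  have le1 := leq_trans (leq_addr _ _) le2.
  by rewrite IHy // IHz ?IHt ?map_drop // size_drop leq_subRL.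
transitivity (\sum_(w <- words (iota 0 M) n)
   \sum_(k <- perms n | map (nth 0%N w) k == leaves m) ev e m).
  apply: eq_bigr => w _; rewrite big_seq_cond [RHS]big_seq_cond.
  apply: eq_bigr => k /andP[].
  rewrite mem_filter mem_words => /and3P[_ /eqP sz_k _] /eqP Ek.
  by rewrite ev_fill ?deg_m ?sz_k // Ek fill_leaves.
under eq_bigr do rewrite big_mkcond; rewrite exchange_big /=.
rewrite (eq_big_seq (fun=> ev e m)) => [|k kP].
  by rewrite big_const_seq count_predT iter_addr_0 scaler_nat.
set w0 := map (fun i => nth 0%N (leaves m) (index i k)) (iota 0 n).
have w0W : w0 \in words (iota 0 M) n.
  rewrite mem_words size_map size_iota eqxx /=; apply/allP => x /mapP[j].
  rewrite mem_iota => /= lt_j {x}->.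
  have := mem_filter uniq k (words (iota 0 n) n).
  rewrite kP mem_words => /esym/and3P[uk /eqP sz_k /allP k_n].
  have [|_ Ek] := uniq_min_size uk k_n; first by rewrite size_iota sz_k.
  rewrite mem_iota.
  have /allP/(_ (nth 0%N (leaves m) (index j k))) := L_M _ mL; apply.
  by rewrite mem_nth // size_leaves deg_m -sz_k index_mem Ek mem_iota.
have w0P w : w \in words (iota 0 M) n ->
    (map (nth 0%N w) k == leaves m) = (w == w0).
  rewrite mem_words => /andP[/eqP sz_w _].
  by rewrite (@map_nth_perm_eq n) // size_leaves.
rewrite (bigD1_seq w0) ?words_uniq ?iota_uniq //= w0P // eqxx.
by rewrite big1_seq ?addr0 // => w /andP[/negPf w_w0 /w0P->]; rewrite w_w0.
Qed.

End Polarization.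

(** * Identities of V(6) *)

Section Transfer.

Variables (K : numFieldType) (W : lmodType K).
Variables (br : W -> W -> W) (tr : W -> W -> W -> W).
Hypothesis br_bilin : bilin br.
Hypothesis tr_trilin : trilinear tr.
Hypothesis ids : forall r, r \in identitiesZ -> holds br tr r.
Local Notation ev := (nmono_eval br tr).
Local Notation evV := (nmono_eval (@alpha K) (@beta_act K)).

(** By reconstruction the polarization in W is a combination of the g_i, whose
    coefficients are coordinate sums of the polarization in V(6). *)
Lemma polar_transfer n L c w y : (0 < n <= 5)%N ->
  all (fun m => nmono_degree m == n) L ->
  (forall x, polar (@alpha K) (@beta_act K) n L c w x = 0) ->
  polar br tr n L c w y = 0.
Proof.
move=> n5 /allP L_n V0; have ck := check_cert n5.
have [g sz_g Eg] := reconstruction br_bilin tr_trilin ids y ck.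
set ws := cert_words (cert n) in sz_g Eg.
have /allP ws7 : all (all (gtn 7)) ws.
  by move: ck; rewrite /check /ws; case: (cert n) => ? ? ? ? /andP[].
pose f i m : K := ofZ K (weight_eval (nth [::] ws i) m).1.
transitivity (\sum_(i < size ws) (\sum_(m <- L) c m *
    \sum_(k <- perms n | map (nth 0%N w) k == leaves m) f i (fill k m))
      *: nth 0 g i).
  under [RHS]eq_bigr do rewrite scaler_suml; rewrite exchange_big.
  apply: eq_big_seq => m mL /=.
  under [RHS]eq_bigr do rewrite -scalerA scaler_suml.
  rewrite -scaler_sumr; congr (_ *: _); rewrite exchange_big /=.
  rewrite big_seq_cond [RHS]big_seq_cond; apply: eq_bigr => k /andP[kP _].
  by rewrite Eg ?dot_phi // mem_multilinear //; apply/eqP/L_n.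
apply: big1 => i _; set s := \sum_(m <- L) _; suff -> : s = 0 by rewrite scale0r.
have w7 : all (gtn 7) (nth [::] ws i) by rewrite ws7 ?mem_nth.
have := V0 (fun j => weight_vec K (nth 0%N (nth [::] ws i) j)).
move=> /(congr1 (@coord_sum K)); rewrite (linear_comb _ _ _ (@coord_sum_linear K)).
rewrite [RHS]big1 => [|j _]; last by rewrite mxE.
move=> sum0; rewrite -[RHS]sum0; apply: eq_bigr => m _; congr (_ * _).
under [in RHS]eq_bigr do rewrite -[nmono_eval _ _ _ _]scale1r.
rewrite -[in RHS]big_filter (linear_comb _ _ _ (@coord_sum_linear K)) big_filter.
by apply: eq_bigr => k _; rewrite scale1r coord_sum_eval.
Qed.

Lemma homogeneous_consequence n L c e : (0 < n <= 5)%N ->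
  all (fun m => nmono_degree m == n) L ->
  (forall x, \sum_(m <- L) c m *: evV x m = 0) ->
  \sum_(m <- L) c m *: ev e m = 0.
Proof.
move=> n5 L_n V0; pose M := (\max_(m <- L) \max_(i <- leaves m) i).+1.
have L_M : all (fun m => all (gtn M) (leaves m)) L.
  apply/allP => m mL; apply/allP => i im; rewrite /= ltnS.
  have le_i : (i <= \max_(k <- leaves m) k)%N by apply: leq_bigmax_seq im isT.
  by apply: (leq_trans le_i); apply: (leq_bigmax_seq _ mL isT).
apply: (scalerI (_ : (size (perms n))%:R != 0 :> K)).
  rewrite pnatr_eq0 -lt0n -has_predT; apply/hasP; exists (iota 0 n) => //.
  by rewrite mem_filter iota_uniq mem_words size_iota eqxx; apply/allP.
rewrite scaler0 -(sum_polar br tr c e L_n L_M) big1 // => w _.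
apply: polar_transfer => // x.
by apply: polar_eq0 => //; [exact: alpha_bilin|exact: beta_act_trilin].
Qed.

End Transfer.

(** Replacing x by t x multiplies the component of degree d by t^d, so each
    coordinate of the components gives a coefficient of a polynomial in t of
    degree at most N which vanishes for t = 0, ..., N. *)
Lemma homogeneous_component (K : numFieldType) (d N : nat) (L : seq nmono)
    (c : nmono -> K) (ev := nmono_eval (@alpha K) (@beta_act K)) :
  all (fun m => nmono_degree m <= N)%N L ->
  (forall x, \sum_(m <- L) c m *: ev x m = 0) ->
  forall x, \sum_(m <- L | nmono_degree m == d) c m *: ev x m = 0.
Proof.
move=> /allP L_N V0 x; have linZ := @linear_scale K (V6 K) (V6 K).
have [br1 br2] := @alpha_bilin K; have [tr1 tr2 tr3] := @beta_act_trilin K.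
have ev_scale (t : K) m :
    ev (fun i => t *: x i) m = t ^+ nmono_degree m *: ev x m.
  rewrite /ev; elim: m => [//|y IHy z IHz|y IHy z IHz u IHu] /=.
    by rewrite IHy IHz (linZ _ _ _ (br1 _)) (linZ _ _ _ (br2 _)) scalerA exprD.
  rewrite IHy IHz IHu (linZ _ _ _ (tr1 _ _)) (linZ _ _ _ (tr2 _ _)).
  by rewrite (linZ _ _ _ (tr3 _ _)) !scalerA !exprD.
pose P d := \sum_(m <- L | nmono_degree m == d) c m *: ev x m.
apply/rowP => j; rewrite [RHS]mxE -/(P d).
have [le_d|lt_d] := leqP d N; last first.
  rewrite /P big_seq_cond big1 ?mxE // => m /andP[/L_N le_m /eqP deg_m].
  by rewrite -deg_m ltnNge le_m in lt_d.
pose q := \poly_(i < N.+1) P i 0 j.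
suff q0 : q = 0.
  by have := coef_poly N.+1 (fun i => P i 0 j) d; rewrite ltnS le_d -/q q0 coef0.
apply/eqP; apply: contraT => q_neq0.
have /(max_poly_roots q_neq0) : all (root q) [seq i%:R | i <- iota 0 N.+1].
  apply/allP => _ /mapP[i _ ->]; apply/rootP; rewrite horner_poly.
  have Vj0 := congr1 (fun v : V6 K => v 0 j) (V0 (fun k => i%:R *: x k)).
  rewrite [RHS]mxE in Vj0; rewrite -[RHS]Vj0 summxE.
  under [LHS]eq_bigr do rewrite /P summxE mulr_suml big_mkcond.
  rewrite exchange_big /=; apply: eq_big_seq => m mL.
  have lt_m : (nmono_degree m < N.+1)%N by rewrite ltnS L_N.
  rewrite (bigD1 (Ordinal lt_m)) //= eqxx big1 ?addr0 => [|k /negPf ne].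
    by rewrite ev_scale !mxE mulrAC mulrA.
  by rewrite -[_ == _]/(Ordinal lt_m == k) eq_sym ne.
rewrite map_inj_uniq ?iota_uniq ?size_map ?size_iota => [|a b /eqP].
  by move=> /(_ isT); rewrite ltnNge size_poly.
by rewrite eqr_nat => /eqP.
Qed.

Theorem theorem6p3 (R : realType) (p : nap R[i]) :
  (nap_degree p <= 5)%N ->
  identity_of (@alpha R[i]) (@beta_act R[i]) p ->
  consequence (identities R[i]) p.
Proof.
move=> deg_p V0 W br tr tr_trilin ids e.
have deg_m m : m \in msupp p -> (nmono_degree m <= 5)%N.
  by move=> mp; apply: leq_trans deg_p; apply: (leq_bigmax_seq _ mp isT).
have br_bilin : bilin br by split=> x a u v; [exact: linearPl|exact: linearPr].
have ids' r : r \in identitiesZ -> holds br tr r.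
  move=> rI e'; rewrite -nap_eval_of; apply: ids; rewrite -nap_of_identities.
  exact: map_f.
transitivity (\sum_(d < 6) \sum_(m <- msupp p | nmono_degree m == d)
                p@_m *: nmono_eval br tr e m).
  under [RHS]eq_bigr do rewrite big_mkcond; rewrite exchange_big /=.
  apply: eq_big_seq => m /deg_m lt_m.
  rewrite (bigD1 (Ordinal (lt_m : (_ < 6)%N))) //= eqxx.
  rewrite big1 ?addr0 // => d /negPf ne; rewrite eq_sym in ne.
  by rewrite -[_ == _]/(Ordinal (lt_m : (_ < 6)%N) == d) ne.
apply: big1 => -[d lt_d] _ /=; rewrite -big_filter.
have [->|d_gt0] := posnP d.
  rewrite big_filter big1 // => m /eqP deg0.
  by have := nmono_degree_gt0 m; rewrite deg0.
apply: (@homogeneous_consequence _ _ _ _ br_bilin tr_trilin ids' d).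
- by rewrite d_gt0.
- exact: filter_all.
move=> x; rewrite big_filter.
by apply: (@homogeneous_component _ d 5) => //; apply/allP.
Qed.
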